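(* Let $a,b,c$ be positive constants, $k\in(-\pi,\pi]^2$, and consider in $L^2(\mathbb T^2)$, $\mathbb T^2=\mathbb R^2/\mathbb Z^2$, the operators $$A_k=-\frac1a\Delta_k+\frac ba,\quad\operatorname{dom}A_k=H^2(\mathbb T^2),\qquad B=\sqrt{\frac{cb}a}\,I_{L^2(\mathbb T^2)},$$ the block operator matrix $\mathcal A_k=\begin{pmatrix} A_k & B \\ B^* & c \end{pmatrix}$ in $L^2(\mathbb T^2)\oplus L^2(\mathbb T^2)$ with $\operatorname{dom}\mathcal A_k=H^2(\mathbb T^2)\oplus L^2(\mathbb T^2)$, and its Schur complement $\mathcal S_k(\lambda)=A_k-\lambda-\frac{cb}{a}\frac1{c-\lambda}$, $\lambda\in\mathbb C\setminus\{c\}$ (these correspond to the space-independent permittivity $\epsilon(\lambda)=a+\frac b{c-\lambda}$). Let $(\nu_j(A_k))_{j=1}^\infty$ be the eigenvalues of $A_k$, ordered non-decreasingly and counted with multiplicities. Then the two sequences of eigenvalues of $\mathcal A_k$ accumulating at $c$ (lying in $(-\infty,c)$) and at $\infty$ (lying in $(c,\infty)$), ordered non-decreasingly and counted with multiplicities, are $$\lambda_{1,j}=\frac12(\nu_j(A_k)+c)-\sqrt{\frac14(\nu_j(A_k)-c)^2+\frac{cb}a},\qquad\lambda_{2,j}=\frac12(\nu_j(A_k)+c)+\sqrt{\frac14(\nu_j(A_k)-c)^2+\frac{cb}a},\quad j\in\mathbb N;$$ the index shift $\kappa_2$ (the number of negative eigenvalues of $\mathcal S_k(c+\delta)$ for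 any $\delta>0$ with $c<c+\delta<\lambda_{2,1}$) is $\kappa_2=0$; and the two-sided bounds defined in the context are all equalities, i.e. $$\lambda_{1,j}^L=\lambda_{1,j}=\lambda_{1,j}^U,\qquad\lambda_{2,j}^L=\lambda_{2,j}=\lambda_{2,j}^U,\quad j\in\mathbb N.$$
   Context: $\Delta_k=\langle\nabla+\mathrm ik,\nabla+\mathrm ik\rangle=\Delta+2\mathrm i\langle k,\nabla\rangle-|k|^2$ in $L^2(\mathbb T^2)$ with domain $H^2(\mathbb T^2)$; $\sigma(-\Delta_k)=\{|2\pi n+k|^2:n\in\mathbb Z^2\}$. For $A$ self-adjoint with compact resolvent and bounded from below with eigenvalues $\nu_j(A)$, bounded $B$ and $c\in\mathbb R$, the general two-sided bounds are $$\lambda_{1,j}^L=\frac{\nu_j(A)+c}2-\sqrt{\Big(\frac{\nu_j(A)-c}2\Big)^2+\|B\|^2},\quad\lambda_{1,j}^U=\frac{\nu_j(A)+c}2-\sqrt{\Big(\frac{\nu_j(A)-c}2\Big)^2+\min\sigma(BB^* )},$$ $$\lambda_{2,j}^L=\frac{\nu_j(A)+c}2+\sqrt{\Big(\frac{\nu_j(A)-c}2\Big)^2+\min\sigma(BB^* )},\quad\lambda_{2,j}^U=\frac{\nu_j(A)+c}2+\sqrt{\Big(\frac{\nu_j(A)-c}2\Big)^2+\|B\|^2},$$ here applied with $A=A_k$. *)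

(* Defs.v *)
From HB Require Import structures.
From mathcomp Require Import all_boot all_order all_algebra.
From mathcomp Require Import generic_quotient ring_quotient.
From mathcomp Require Import all_classical all_reals all_analysis.
From mathcomp Require Import complex.

Set Implicit Arguments.
Unset Strict Implicit.
Unset Printing Implicit Defensive.

Import Order.TTheory GRing.Theory Num.Theory.
Import numFieldNormedType.Exports.

Local Open Scope classical_set_scope.
Local Open Scope ring_scope.
Local Open Scope complex_scope.

Section Operators.
Variables (R : realType) (V : lmodType R[i]).

(* An unbounded operator: the values of [app] outside [dom] are irrelevant. *)
Record operator := Operator { dom : set V; app :> V -> V }.

Definition eigen_space (A : operator) (z : R[i]) : set V :=
  [set u | dom A u /\ A u = z *: u].

Definition has_dim (E : set V) (n : nat) : Prop :=
  exists e : 'I_n -> V,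
    (forall x : 'I_n -> R[i], \sum_i x i *: e i = 0 -> forall i, x i = 0) /\
    E = [set u | exists x : 'I_n -> R[i], u = \sum_i x i *: e i].

(* [s] lists the eigenvalues of [A] lying in [D], non-decreasingly and each
   one repeated according to its (finite, geometric) multiplicity; a [z] in
   [D] that is not an eigenvalue has multiplicity 0 and is not listed. *)
Definition eigenvalue_sequence (A : operator) (D : set R[i]) (s : nat -> R) :
    Prop :=
  [/\ forall i j : nat, (i <= j)%N -> s i <= s j,
      forall j, D (s j)%:C &
      forall z, D z -> exists n : nat,
        has_dim (eigen_space A z) n /\ ([set j | (s j)%:C = z] #= `I_n)%card].

(* [A] has exactly [n] negative eigenvalues, counted with multiplicity. *)
Definition negative_eigenvalue_count (A : operator) (n : nat) : Prop :=
  exists s : seq R,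
    [/\ size s = n, forall x, x \in s -> x < 0 &
        forall x : R, x < 0 -> has_dim (eigen_space A x%:C) (count_mem x s)].

End Operators.

Section BoundedOperators.
Variables (R : realType) (V : lmodType R[i]) (dot : V -> V -> R[i]).

Definition hnorm (u : V) : R := Num.sqrt (complex.Re (dot u u)).

Definition opnorm (B : V -> V) : R :=
  sup [set hnorm (B u) | u in [set u | hnorm u <= 1]].

(* The adjoint of an everywhere defined bounded operator. *)
Definition adjoint (B : V -> V) : V -> V :=
  xget (fun=> 0) [set S : V -> V | forall u v, dot (B u) v = dot u (S v)].

Definition bounded (S : V -> V) : Prop :=
  exists M : R, forall u, hnorm (S u) <= M * hnorm u.

(* Spectrum of an everywhere defined bounded operator. *)
Definition spectrum (B : V -> V) : set R[i] :=
  [set z | ~ exists S : V -> V,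
     [/\ linear S, bounded S,
         forall u, S (B u - z *: u) = u &
         forall u, B (S u) - z *: S u = u]].

(* The order of [R[i]] is the partial one, so that [m%:C <= z] forces [z] to
   be real. *)
Definition min_spectrum (B : V -> V) : R :=
  xget 0 [set m : R | spectrum B m%:C /\
                      forall z, spectrum B z -> m%:C <= z].

Definition block_operator (A : operator V) (B : V -> V) (c : R) :
    operator (V * V)%type :=
  {| dom := [set u : V * V | dom A u.1];
     app := fun u : V * V => (A u.1 + B u.2, adjoint B u.1 + c%:C *: u.2) |}.

Definition lambda1L (nu c : R) (B : V -> V) : R :=
  (nu + c) / 2 - Num.sqrt (((nu - c) / 2) ^+ 2 + opnorm B ^+ 2).
Definition lambda1U (nu c : R) (B : V -> V) : R :=
  (nu + c) / 2 -
  Num.sqrt (((nu - c) / 2) ^+ 2 + min_spectrum (B \o adjoint B)).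
Definition lambda2L (nu c : R) (B : V -> V) : R :=
  (nu + c) / 2 +
  Num.sqrt (((nu - c) / 2) ^+ 2 + min_spectrum (B \o adjoint B)).
Definition lambda2U (nu c : R) (B : V -> V) : R :=
  (nu + c) / 2 + Num.sqrt (((nu - c) / 2) ^+ 2 + opnorm B ^+ 2).

End BoundedOperators.

(* Functions on the torus R^2/Z^2 are identified with functions on the unit
   square, the normalised Lebesgue measure being the product of the uniform
   measures on [0, 1]; values outside of the square are irrelevant. *)
Definition torus_measure (R : realType) :
    {measure set (measurableTypeR R * measurableTypeR R) -> \bar R} :=
  (uniform_prob (@ltr01 R) \x uniform_prob (@ltr01 R))%E.

Section L2.
Variable R : realType.
Local Notation T := (measurableTypeR R * measurableTypeR R)%type.
Local Notation mu := (torus_measure R).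

Definition sqint : {pred T -> R[i]^o} :=
  [pred f : T -> R[i]^o |
    ((fun x => complex.Re (f x)) \in Lfun mu 2%:E) &&
    ((fun x => complex.Im (f x)) \in Lfun mu 2%:E)].

Lemma sqint_submod_closed : submod_closed sqint.
Proof.
have [L0 LD] := Lfun_submod_closed mu (lee1n 2).
have {}LD (a : R) (f g : T -> R) : f \in Lfun mu 2%:E -> g \in Lfun mu 2%:E ->
    (fun x => a * f x + g x) \in Lfun mu 2%:E by exact: LD.
split; first by rewrite inE /=; apply/andP; split; apply: L0.
move=> [a b] f g; rewrite !inE /= => /andP[f1 f2] /andP[g1 g2].
apply/andP; split.
- have := LD a _ _ f1 (LD (- b) _ _ f2 g1).
  rewrite [X in X \in _ -> _](_ : _ =
    fun x => complex.Re (((a +i* b) *: f + g) x)) //.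
  apply/funext => x; rewrite !fctE.
  by case: (f x) => ? ?; case: (g x) => ? ? /=; rewrite addrA mulNr.
- have := LD a _ _ f2 (LD b _ _ f1 g2).
  rewrite [X in X \in _ -> _](_ : _ =
    fun x => complex.Im (((a +i* b) *: f + g) x)) //.
  apply/funext => x; rewrite !fctE.
  by case: (f x) => ? ?; case: (g x) => ? ? /=; rewrite addrA.
Qed.

HB.instance Definition _ :=
  GRing.isSubmodClosed.Build _ _ sqint sqint_submod_closed.

Record sqintType := SqInt { sqint_val :> T -> R[i]^o; _ : sqint_val \in sqint }.
HB.instance Definition _ := [isSub for sqint_val].
HB.instance Definition _ := [Choice of sqintType by <:].
HB.instance Definition _ := [SubChoice_isSubLmodule of sqintType by <:].

Definition ae0 : {pred sqintType} :=
  mem [set f : sqintType | \forall x \ae mu, f x = 0].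

Lemma ae0_submod_closed : submod_closed ae0.
Proof.
split; first by rewrite inE /=; exact: nearW.
move=> a f g; rewrite !inE /= => f0 g0.
by near=> x; rewrite /= !fctE (near f0 x)// (near g0 x)// scaler0 addr0.
Unshelve. all: by end_near. Qed.

HB.instance Definition _ :=
  GRing.isSubmodClosed.Build _ _ ae0 ae0_submod_closed.

Local Open Scope quotient_scope.

Definition L2 : Type := Quotient.quot ae0.
HB.instance Definition _ := GRing.Zmodule.on L2.
HB.instance Definition _ := EqQuotient.on L2.

Definition L2_scale (a : R[i]) (f : L2) : L2 := \pi_L2 (a *: repr f).

Let L2_piP (f g : sqintType) : f - g \in ae0 -> \pi_L2 f = \pi_L2 g.
Proof. by rewrite Quotient.idealrBE => /eqP. Qed.

Let L2_reprP (f : sqintType) : repr (\pi_L2 f) - f \in ae0.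
Proof. by rewrite Quotient.idealrBE; apply/eqP; exact: reprK. Qed.

Let L2_piD (f g : sqintType) : \pi_L2 (f + g) = \pi_L2 f + \pi_L2 g.
Proof. by rewrite !piE. Qed.

Let L2_scale_pi a (f : sqintType) : L2_scale a (\pi_L2 f) = \pi_L2 (a *: f).
Proof. by apply: L2_piP; rewrite -scalerBr rpredZ. Qed.

Let L2_scalerA a b f : L2_scale a (L2_scale b f) = L2_scale (a * b) f.
Proof.
elim/quotW: f => f.
by rewrite (L2_scale_pi b f) (L2_scale_pi a) (L2_scale_pi (a * b) f) scalerA.
Qed.

Let L2_scale1r : left_id 1 L2_scale.
Proof. by elim/quotW => f; rewrite (L2_scale_pi 1 f) scale1r. Qed.

Let L2_scalerDr : right_distributive L2_scale +%R.
Proof.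
move=> a; elim/quotW => f; elim/quotW => g.
rewrite -L2_piD (L2_scale_pi a f) (L2_scale_pi a g) (L2_scale_pi a (f + g)).
by rewrite scalerDr L2_piD.
Qed.

Let L2_scalerDl f : {morph L2_scale^~ f : a b / a + b}.
Proof.
elim/quotW: f => f a b.
by rewrite (L2_scale_pi a f) (L2_scale_pi b f) (L2_scale_pi (a + b) f)
  scalerDl L2_piD.
Qed.

HB.instance Definition _ := GRing.Zmodule_isLmodule.Build R[i] L2
  L2_scalerA L2_scale1r L2_scalerDr L2_scalerDl.

Definition cintegral (f : T -> R[i]) : R[i] :=
  (\int[mu]_x complex.Re (f x)) +i* (\int[mu]_x complex.Im (f x)).

Definition L2_dot (f g : L2) : R[i] :=
  cintegral (fun x => repr f x * (repr g x)^*).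

End L2.

Section Sobolev.
Variable R : realType.
Local Notation L2 := (L2 R).

Definition dir (i : bool) : R * R := if i then (0, 1) else (1, 0).

Definition pderiv (s : seq bool) (phi : R * R -> R) : R * R -> R :=
  foldr (fun i psi x => 'D_(dir i) psi x) phi s.

(* Smooth functions on the torus, as Z^2-periodic smooth functions on R^2. *)
Definition test_function (phi : R * R -> R) : Prop :=
  (forall i x, phi (x + dir i) = phi x) /\
  forall s x, {for x, continuous (pderiv s phi)} /\
              forall i, derivable (pderiv s phi) x (dir i).

(* Real test functions suffice, the weak formulation being linear in phi. *)
Definition is_weak_deriv (s : seq bool) (f g : L2) : Prop :=
  forall phi, test_function phi ->
    cintegral (fun x => repr f x * (pderiv s phi x)%:C) =
    (-1) ^+ size s * cintegral (fun x => repr g x * (phi x)%:C).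

Definition weak_deriv (s : seq bool) (f : L2) : L2 :=
  xget 0 [set g | is_weak_deriv s f g].

Definition H2 : set L2 :=
  [set f | forall s, (size s <= 2)%N -> exists g, is_weak_deriv s f g].

(* <nabla + ik, nabla + ik> = Delta + 2i <k, nabla> - |k|^2 *)
Definition Delta (k : R * R) (f : L2) : L2 :=
  weak_deriv [:: false; false] f + weak_deriv [:: true; true] f
  + (2 * 'i) *: (k.1%:C *: weak_deriv [:: false] f +
                 k.2%:C *: weak_deriv [:: true] f)
  - (k.1 ^+ 2 + k.2 ^+ 2)%:C *: f.

Definition A_op (a b : R) (k : R * R) : operator L2 :=
  {| dom := H2; app := fun f => - (a^-1%:C *: Delta k f) + (b / a)%:C *: f |}.

Definition B_op (a b c : R) (f : L2) : L2 := (Num.sqrt (c * b / a))%:C *: f.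

Definition schur_op (a b c : R) (k : R * R) (lam : R[i]) : operator L2 :=
  {| dom := dom (A_op a b k);
     app := fun f => A_op a b k f - lam *: f
                     - ((c * b / a)%:C * (c%:C - lam)^-1) *: f |}.

End Sobolev.

(* Main.v *)
Require Import Defs.
From mathcomp Require Import all_boot all_order all_algebra.
From mathcomp Require Import generic_quotient ring_quotient.
From mathcomp Require Import all_classical all_reals all_analysis.
From mathcomp Require Import measurable_realfun.
From mathcomp Require Import complex.
From mathcomp Require Import ring lra zify.

Set Implicit Arguments.
Unset Strict Implicit.
Unset Printing Implicit Defensive.

Import Order.TTheory GRing.Theory Num.Theory.
Import numFieldNormedType.Exports.

Local Open Scope classical_set_scope.
Local Open Scope ring_scope.
Local Open Scope complex_scope.

(** On the Fourier side all operators are explicit. A function of [L2] is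
    determined by its coefficients against the waves exp (2 pi i n.x), and a weak
    derivative multiplies the [n]-th coefficient by a power of 2 pi i n, by
    integration by parts on the torus. Hence A_k acts on the [n]-th coefficient as
    multiplication by [energy n] = (|2 pi n + k|^2 + b) / a, its eigenspaces are
    spanned by finitely many waves, and sorting the energies gives the sequence nu.
    Since B is a multiple of the identity, (u, v) is an eigenvector of the block
    operator for lambda <> c iff v is the corresponding multiple of u and u is an
    eigenvector of A_k for lambda - (c b / a) / (lambda - c). This function of
    lambda increases on each side of c, with inverses nu |-> lambda_1, lambda_2.

    Completeness of the waves: an integrable function orthogonal to all
    trigonometric polynomials is, by dominated convergence, orthogonal to the
    indicators of the quadrants x1 < al, x2 < be, because these are bounded
    pointwise limits of trigonometric polynomials on the open unit square. It then
    vanishes by Dynkin's theorem. *)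

(** * Integration over the torus *)

Section TorusMeasure.
Variable R : realType.
Local Notation T := (measurableTypeR R * measurableTypeR R)%type.
Local Notation mu := (torus_measure R).

Lemma torus_measureT : mu setT = 1%E.
Proof.
exact: (@probability_setT _ _ _
  (uniform_prob (@ltr01 R) \x uniform_prob (@ltr01 R))%E).
Qed.

Lemma bounded_integrable (g : T -> R) (M : R) : measurable_fun setT g ->
  (forall x, `|g x| <= M) -> mu.-integrable setT (EFin \o g).
Proof.
move=> mg gM; apply: (@le_integrable _ _ _ mu _ measurableT _ (EFin \o cst M)).
- exact/measurable_EFinP.
- by move=> x _; rewrite /= lee_fin (le_trans (gM x))// ler_norm.
- apply/integrableP; split; first exact/measurable_EFinP.
  under eq_integral do rewrite /=.
  by rewrite integral_cst//= torus_measureT mule1 ltry.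
Qed.

(** The measurable structure on the plane is generated by boxes, not by open sets; an open set is
    the countable union of the boxes with rational centre and radius that it contains. *)
Lemma open_measurable_prod (A : set (R * R)) :
  open A -> measurable (A : set T).
Proof.
move=> oA.
pose B (q : rat * rat * rat) : set T :=
  ball (ratr q.1.1 : R) (ratr q.2) `*` ball (ratr q.1.2 : R) (ratr q.2).
have -> : A = \bigcup_(q in [set q | B q `<=` A]) B q.
  apply/seteqP; split => [x Ax|x [q /= qA]]; last exact: qA.
  have /nbhs_ballP[e /= e0 xeA] : nbhs x A by rewrite nbhsE; exists A.
  have [r /[!in_itv]/= /andP[r0 re]] : exists r, ratr r \in `]0, (e / 2)[.
    by apply: rat_in_itvoo; rewrite divr_gt0.
  have qP (y : R) : exists q, `|ratr q - y| < ratr r.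
    have [q /[!in_itv]/= /andP[q1 q2]] :
        exists q, ratr q \in `](y - ratr r), (y + ratr r)[.
      by apply: rat_in_itvoo; rewrite ltrD2l gtrN.
    by exists q; rewrite ltr_norml ltrBrDl q1 ltrBlDl q2.
  have [[q1 q1x] [q2 q2x]] := (qP x.1, qP x.2).
  exists (q1, q2, r); last by split.
  have aux (u v w : R) : `|u - w| < ratr r -> `|u - v| < ratr r -> `|w - v| < e.
    move=> uw uv; rewrite (_ : w - v = (u - v) - (u - w)); last by ring.
    by rewrite (le_lt_trans (ler_normB _ _))// (splitr e) ltrD// (lt_trans _ re).
  move=> y [/= By1 By2]; apply: xeA; split.
    by rewrite /ball /= distrC; exact: aux By1 q1x.
  by rewrite /ball /= distrC; exact: aux By2 q2x.
rewrite bigcup_mkcond; apply: countable_bigcupT_measurable => [|q];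
  first exact: countableP.
case: ifP => _; last exact: measurable0.
by apply: measurableX; apply: open_measurable; exact: ball_open.
Qed.

Lemma continuous_measurable_prod (g : R * R -> R) :
  continuous g -> measurable_fun (setT : set T) (g : T -> R).
Proof.
move=> /continuousP cg; apply: (measurability _ (RGenOpens.measurableE R)).
move=> _ [_ [a [b ->] <-]]; rewrite setTI.
by apply: open_measurable_prod; apply: cg; exact: interval_open.
Qed.

Lemma integral_uniform01 (f : R -> \bar R) : measurable_fun setT f ->
  (\int[uniform_prob (@ltr01 R)]_x f x =
   \int[lebesgue_measure]_(x in `[0%R, 1%R]) f x)%E.
Proof.
move=> mf; rewrite integralE [RHS]integralE.
rewrite !(integral_uniform (@ltr01 R)) ?subr0 ?invr1 ?mul1e//.
  exact: measurable_funeneg.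
exact: measurable_funepos.
Qed.

Lemma integral_derive_periodic (h h' : R -> R) :
  (forall x : R, is_derive x 1 h (h' x)) -> continuous h' -> h 1 = h 0 ->
  (\int[uniform_prob (@ltr01 R)]_x (h' x)%:E = 0)%E.
Proof.
move=> hh' ch' h10.
have ch : continuous h.
  by move=> x; apply/differentiable_continuous/derivable1_diffP; case: (hh' x).
rewrite integral_uniform01; last first.
  by apply/measurable_EFinP; exact: continuous_measurable_fun.
rewrite (@continuous_FTC2 _ h' h) //.
- by rewrite h10 subee.
- exact: continuous_subspaceT.
- split; first by move=> x _; case: (hh' x).
  + exact/cvg_at_right_filter/ch.
  + exact/cvg_at_left_filter/ch.
- by move=> x _; rewrite derive1E; exact: derive_val.
Qed.

End TorusMeasure.

(** * Directional derivatives and periodic functions *)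

Section DirectionalDerivative.
Variable R : realType.
Local Notation T := (measurableTypeR R * measurableTypeR R)%type.
Local Notation mu := (torus_measure R).

(** The two difference quotients are the same function of the increment. This makes the one-variable
    chain rule and fundamental theorem of calculus available along lines. *)
Lemma is_derive_lineP (f : R * R -> R) (x v : R * R) (t d : R) :
  is_derive (t *: v + x) v f d <->
  is_derive t 1 (fun s : R => f (s *: v + x)) d.
Proof.
have E : (fun h : R => h^-1 *: (((fun s : R => f (s *: v + x)) \o shift t)
      (h *: (1 : R)) - (fun s : R => f (s *: v + x)) t)) =
    (fun h : R => h^-1 *: ((f \o shift (t *: v + x)) (h *: v)
      - f (t *: v + x))).
  apply/funext => h /=; congr (_ *: (f _ - _)).
  by rewrite scaler1 scalerDl addrA.
by split => -[dx vx]; apply: DeriveDef;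
  move: dx vx; rewrite /derivable /derive E.
Qed.

Lemma is_derive_line0P (f : R * R -> R) (x v : R * R) (d : R) :
  is_derive x v f d <-> is_derive (0 : R) 1 (fun s : R => f (s *: v + x)) d.
Proof. by rewrite -is_derive_lineP scale0r add0r. Qed.

(** By Fubini one integrates first along direction [i], where the fundamental theorem over one
    period gives zero. This is the source of all integrations by parts below. *)
Lemma integral_pderiv_eq0 (i : bool) (psi : R * R -> R) (M : R) :
  (forall x, derivable psi x (dir R i)) ->
  continuous (fun x => 'D_(dir R i) psi x) ->
  (forall x, `|'D_(dir R i) psi x| <= M) ->
  (forall x, psi (x + dir R i) = psi x) ->
  \int[mu]_x 'D_(dir R i) psi x = 0.
Proof.
move=> dpsi cD bD psiP; rewrite /Rintegral.
have iD := bounded_integrable (continuous_measurable_prod cD) bD.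
suff -> : (\int[mu]_x ('D_(dir R i) psi x)%:E = 0)%E by [].
have line (y : R * R) : (\int[uniform_prob (@ltr01 R)]_t
    ('D_(dir R i) psi (t *: dir R i + y))%:E = 0)%E.
  apply: (@integral_derive_periodic R (fun t => psi (t *: dir R i + y))).
  - by move=> t; apply/is_derive_lineP; exact: derivableP.
  - have cl : continuous (fun t : R => t *: dir R i + y).
      by move=> t; apply: cvgD; [exact: scalel_continuous|exact: cvg_cst].
    by move=> t; exact: (continuous_comp (cl t) (cD _)).
  - by rewrite scale1r scale0r add0r addrC.
(* The inner integral has to run over the variable moved by [dir R i]: the second one for [true],
   the first one for [false]. *)
case: i line dpsi cD bD psiP iD => line dpsi cD bD psiP iD.
- rewrite -(integral12_prod_meas1 iD) integral0_eq// => x _.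
  rewrite /fubini_F -[RHS](line (x, 0)).
  apply: eq_integral => t _; congr (_%:E); congr ('D_ _ _ _).
  by rewrite /dir; congr (_, _) => /=; rewrite ?scaler0 ?scaler1 ?addr0 ?add0r.
- rewrite -(integral21_prod_meas1 iD) integral0_eq// => x _.
  rewrite /fubini_G -[RHS](line (0, x)).
  apply: eq_integral => t _; congr (_%:E); congr ('D_ _ _ _).
  by rewrite /dir; congr (_, _) => /=; rewrite ?scaler0 ?scaler1 ?addr0 ?add0r.
Qed.

Lemma periodic_int (g : R * R -> R) (i : bool) :
  (forall x, g (x + dir R i) = g x) ->
  forall (n : int) x, g (x + n%:~R *: dir R i) = g x.
Proof.
move=> gP; have gN (n : nat) x : g (x + n%:R *: dir R i) = g x.
  elim: n x => [x|n IH x]; first by rewrite scale0r addr0.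
  by rewrite -natr1 scalerDl scale1r addrA gP.
case=> n x; first exact: gN.
by rewrite NegzE mulrNz scaleNr -(gN n.+1) -addrA addNr addr0.
Qed.

Lemma periodic_bounded (g : R * R -> R) : continuous g ->
  (forall i x, g (x + dir R i) = g x) -> exists M, forall x, `|g x| <= M.
Proof.
move=> cg gP.
have cS : compact (`[0, 1]%classic `*` `[0, 1]%classic : set (R * R)).
  by apply: compact_setX; exact: segment_compact.
have /compact_bounded[M [Mr bM]] :
    compact (g @` (`[0, 1]%classic `*` `[0, 1]%classic : set (R * R))).
  by apply: continuous_compact => //; exact: continuous_subspaceT.
exists (M + 1) => -[x y].
(* The fractional parts represent the point in the compact square, where continuity gives the
   bound. *)
pose z := (x - (Num.floor x)%:~R, y - (Num.floor y)%:~R).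
have -> : g (x, y) = g z.
  rewrite -[RHS](periodic_int (gP false) (Num.floor x)).
  rewrite -[RHS](periodic_int (gP true) (Num.floor y)); congr g.
  rewrite /z /dir; congr (_, _) => /=;
    by rewrite ?scaler0 ?[_%:A]mulr1 ?addr0 subrK.
apply: (bM (M + 1)); first by rewrite ltrDl.
have fl (t : R) : 0 <= t - (Num.floor t)%:~R <= 1.
  by have := floor_itv t; rewrite intrD; lra.
by exists z => //; split; rewrite /= in_itv/=.
Qed.

End DirectionalDerivative.

(** * Completeness of the trigonometric system *)

Section Step.
Variable R : realType.
Implicit Types (r s t y : R) (n : nat).

Lemma bernoulli_inequality y n : -1 <= y -> 1 + n%:R * y <= (1 + y) ^+ n.
Proof.
move=> y1; elim: n => [|n IH]; first by rewrite mul0r addr0 expr0.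
have y0 : 0 <= 1 + y by lra.
rewrite exprS; apply: le_trans (ler_wpM2l y0 IH); rewrite -natr1.
have : 0 <= n%:R * y ^+ 2 by rewrite mulr_ge0 ?sqr_ge0.
nra.
Qed.

Lemma natr_geometric_le r n : 0 <= r <= 1 -> n%:R * r ^+ n * (1 - r) <= 1.
Proof.
move=> /andP[r0 r1].
(* The extra term [r ^+ n] makes the left side non-increasing in [n], so that induction applies. *)
suff : r ^+ n * (n%:R * (1 - r) + 1) <= 1.
  by have := exprn_ge0 n r0; nra.
elim: n => [|n]; first by rewrite mul0r add0r expr0 mulr1.
apply: le_trans; rewrite exprSr -natr1 -mulrA ler_wpM2l ?exprn_ge0//.
have : 0 <= n%:R * ((1 - r) * (1 - r)) by rewrite !mulr_ge0 ?subr_ge0.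
nra.
Qed.

Lemma cvg_natr_geometric r : 0 <= r < 1 -> n%:R * r ^+ n @[n --> \oo] --> 0.
Proof.
(* Write r^n = q^n q^n: one factor absorbs [n] by [natr_geometric_le], the other tends to 0. *)
move=> /andP[r0 r1]; pose q := Num.sqrt r.
have q0 : 0 <= q by exact: sqrtr_ge0.
have q1 : q < 1 by rewrite -sqrtr1 ltr_sqrt.
have C0 : (1 - q)^-1 * q ^+ n @[n --> \oo] --> 0.
  rewrite -[X in _ --> X](mulr0 (1 - q)^-1).
  apply: cvgM; first exact: cvg_cst.
  by apply: cvg_expr; rewrite ger0_norm.
apply: (squeeze_cvgr _ (cvg_cst 0) C0); apply: nearW => n.
rewrite mulr_ge0 ?exprn_ge0//= -(sqr_sqrtr r0) -/q exprAC expr2 mulrA.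
rewrite ler_wpM2r ?exprn_ge0// -[leRHS]mul1r ler_pdivlMr ?subr_gt0//.
by apply: natr_geometric_le; rewrite q0 ltW.
Qed.

(* [stepn n] is a polynomial approximating the indicator of ]0, 1] on [-1, 1]:
   (1 - s^n)^(n 2^n) tends to 1 for s < 1/2 and to 0 for s >= 1/2. *)
Definition stepn n t : R := (1 - ((1 - t) / 2) ^+ n) ^+ (n * 2 ^ n)%N.

Lemma stepn_itv n t : -1 <= t <= 1 -> 0 <= stepn n t <= 1.
Proof.
move=> t1.
have : 0 <= ((1 - t) / 2) ^+ n <= 1.
  by apply/andP; split; [apply: exprn_ge0|apply: exprn_ile1]; lra.
by move=> ?; apply/andP; split; [apply: exprn_ge0|apply: exprn_ile1]; lra.
Qed.

(** Bernoulli's inequality serves twice, with N = n 2^n. If s < 1/2, then (1 - s^n)^N >= 1 - n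
    (2s)^n, which tends to 1. If s >= 1/2, then (1 - s^n)^N (1 + s^n)^N <= 1 while (1 + s^n)^N >= 1
    + n (2s)^n >= n + 1. *)
Lemma cvg_stepn t : -1 <= t <= 1 ->
  stepn n t @[n --> \oo] --> ((0 < t)%R%:R : R).
Proof.
move=> t1; pose s := (1 - t) / 2.
have s0 : 0 <= s by rewrite /s; lra.
have s1 : s <= 1 by rewrite /s; lra.
have E n : (n * 2 ^ n)%N%:R * s ^+ n = n%:R * (2 * s) ^+ n.
  by rewrite natrM natrX [(2 * s) ^+ n]exprMn -mulrA.
have sn n : 0 <= s ^+ n <= 1 by rewrite exprn_ge0// exprn_ile1.
case: ltP => t0; rewrite ?(mulr1n, mulr0n).
- have : 1 - n%:R * (2 * s) ^+ n @[n --> \oo] --> (1 - 0 : R).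
    apply: (@cvgB _ R); first exact: cvg_cst.
    by apply: cvg_natr_geometric; rewrite /s; lra.
  rewrite subr0 => c1; apply: (squeeze_cvgr _ c1 (cvg_cst (1 : R))).
  apply: nearW => n; have /andP[_ ->] := stepn_itv n t1; rewrite andbT.
  rewrite -E -mulrN bernoulli_inequality//.
  by have := sn n; lra.
- apply: (squeeze_cvgr _ (cvg_cst 0) (@cvg_harmonic R)); apply: nearW => n.
  have /andP[-> _] /= := stepn_itv n t1; rewrite /harmonic.
  rewrite -[leRHS]mul1r ler_pdivlMr ?ltr0Sn//.
  have le1 : n.+1%:R <= (1 + s ^+ n) ^+ (n * 2 ^ n)%N :> R.
    apply: le_trans (bernoulli_inequality _ _); last by have := sn n; lra.
    rewrite E -natr1 addrC lerD2l -[leLHS]mulr1 ler_wpM2l// exprn_ege1//.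
    by rewrite /s; lra.
  have := stepn_itv n t1 => /andP[p0 _].
  apply: le_trans (ler_wpM2l p0 le1) _.
  rewrite /stepn -/s -exprMn exprn_ile1//; have := sn n; nra.
Qed.

End Step.

(** * Real trigonometric polynomials and quadrant indicators *)

Section TrigonometricPolynomials.
Variable R : realType.
Local Notation T := (measurableTypeR R * measurableTypeR R)%type.
Local Notation mu := (torus_measure R).
Implicit Types (n m : int * int) (x : R * R).

Definition phase n x : R := 2 * pi * (n.1%:~R * x.1 + n.2%:~R * x.2).

Definition trig_mono n (a b : R) x : R := a * cos (phase n x) + b * sin (phase n x).

(** Scalars are absorbed by the coefficients of the monomials, so sums are the only closure rule;
    closure under products is proved in [trig_polyM]. *)
Inductive trig_poly : (R * R -> R) -> Prop :=
| TrigMono n a b : trig_poly (trig_mono n a b)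
| TrigAdd u v : trig_poly u -> trig_poly v -> trig_poly (fun x => u x + v x).

Lemma phaseD n m x : phase (n + m) x = phase n x + phase m x.
Proof. by rewrite /phase /= !intrD; ring. Qed.

Lemma phaseN n x : phase (- n) x = - phase n x.
Proof. by rewrite /phase /= !mulrNz; ring. Qed.

Lemma phase0 x : phase 0 x = 0.
Proof. by rewrite /phase /= !mul0r addr0 mulr0. Qed.

Lemma trig_poly_cst (a : R) : trig_poly (fun=> a).
Proof.
have := TrigMono 0 a 0; congr trig_poly; apply/funext => x.
by rewrite /trig_mono phase0 cos0 mulr1 mul0r addr0.
Qed.

(** Product-to-sum formulas: monomials of frequencies [n] and [m] multiply to monomials of
    frequencies [n + m] and [n - m]. *)
Lemma trig_polyM u v : trig_poly u -> trig_poly v ->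
  trig_poly (fun x => u x * v x).
Proof.
move=> tu tv; elim: tu => [n a b|u1 u2 _ IH1 _ IH2]; last first.
  have := TrigAdd IH1 IH2; congr trig_poly.
  by apply/funext => x; rewrite mulrDl.
elim: tv => [m c d|v1 v2 _ IH1 _ IH2]; last first.
  have := TrigAdd IH1 IH2; congr trig_poly.
  by apply/funext => x; rewrite mulrDr.
have := TrigAdd
  (TrigMono (n + m) ((a * c - b * d) / 2) ((a * d + b * c) / 2))
  (TrigMono (n - m) ((a * c + b * d) / 2) ((b * c - a * d) / 2)).
congr trig_poly; apply/funext => x.
rewrite /trig_mono !phaseD phaseN !cosD !sinD cosN sinN; lra.
Qed.

Lemma trig_polyX u k : trig_poly u -> trig_poly (fun x => u x ^+ k).
Proof.
move=> tu; elim: k => [|k IH]; first exact: (trig_poly_cst 1).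
have := trig_polyM tu IH; congr trig_poly.
by apply/funext => x; rewrite exprS.
Qed.

Lemma trig_poly_stepn u k : trig_poly u -> trig_poly (fun x => stepn k (u x)).
Proof.
move=> tu; apply: trig_polyX.
have t1 := trig_polyM (trig_poly_cst (- 2^-1)) tu.
have t2 := trig_polyX k (TrigAdd (trig_poly_cst 2^-1) t1).
have := TrigAdd (trig_poly_cst 1) (trig_polyM (trig_poly_cst (-1)) t2).
congr trig_poly; apply/funext => x; rewrite mulN1r; congr (_ - _ ^+ _).
by rewrite mulrBl mul1r mulNr mulrC.
Qed.

Lemma continuous_phase n : continuous (phase n).
Proof.
move=> x; rewrite /phase; apply: cvgM; first exact: cvg_cst.
apply: cvgD; (apply: cvgM; first exact: cvg_cst).
  exact: cvg_fst.
exact: cvg_snd.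
Qed.

Lemma continuous_trig_mono n a b : continuous (trig_mono n a b).
Proof.
move=> x; rewrite /trig_mono.
apply: cvgD; (apply: cvgM; first exact: cvg_cst).
  exact: (continuous_comp (@continuous_phase n x) (@continuous_cos _ _)).
exact: (continuous_comp (@continuous_phase n x) (@continuous_sin _ _)).
Qed.

Lemma continuous_trig_poly u : trig_poly u -> continuous u.
Proof.
elim=> [n a b|{}u v _ cu _ cv x]; first exact: continuous_trig_mono.
by apply: cvgD; [exact: cu|exact: cv].
Qed.

Lemma measurable_trig_poly u : trig_poly u ->
  measurable_fun (setT : set T) (u : T -> R).
Proof. by move=> /continuous_trig_poly; exact: continuous_measurable_prod. Qed.

Lemma bounded_trig_mono n a b x : `|trig_mono n a b x| <= `|a| + `|b|.
Proof.
rewrite (le_trans (ler_normD _ _))// lerD// normrM ler_piMr//.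
  exact: cos_max.
exact: sin_max.
Qed.

Lemma bounded_trig_poly u : trig_poly u -> exists M, forall x, `|u x| <= M.
Proof.
elim=> [n a b|{}u v _ [M uM] _ [N vN]].
  by exists (`|a| + `|b|) => x; exact: bounded_trig_mono.
by exists (M + N) => x; rewrite (le_trans (ler_normD _ _))// lerD.
Qed.

Lemma integrable_mul_bounded (f w : T -> R) (M : R) :
  mu.-integrable setT (EFin \o f) -> measurable_fun setT w ->
  (forall x, `|w x| <= M) -> mu.-integrable setT (EFin \o (fun x => f x * w x)).
Proof.
move=> fi mw wM.
have mf : measurable_fun setT f by apply/measurable_EFinP; case/integrableP: fi.
apply: (@le_integrable _ _ _ mu _ measurableT _
    (EFin \o (fun x => M * f x))) => /=.
- by apply/measurable_EFinP; exact: measurable_funM.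
- move=> x _; rewrite /= lee_fin !normrM mulrC.
  by rewrite ler_wpM2r// (le_trans (wM x))// ler_norm.
- exact: (integrableZl measurableT M fi).
Qed.

(* On the open unit square [coord_step i al] is positive exactly when the [i]-th
   coordinate x is below [al]: it is sin (pi x) sin (pi al) sin (pi (al - x)). *)
Definition coord (i : bool) x : R := if i then x.2 else x.1.
Definition unit_mode (i : bool) : int * int := if i then (0, 1) else (1, 0).
Definition coord_step (i : bool) (al : R) x : R :=
  (sin (2 * pi * coord i x) * (1 - cos (2 * pi * al))
   - sin (2 * pi * al) * (1 - cos (2 * pi * coord i x))) / 4.

Lemma phase_unit_mode i x : phase (unit_mode i) x = 2 * pi * coord i x.
Proof.
by rewrite /phase; case: i => /=; rewrite mul0r mul1r ?addr0 ?add0r.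
Qed.

Lemma trig_poly_coord_step i al : trig_poly (coord_step i al).
Proof.
have := TrigAdd (trig_poly_cst (- sin (2 * pi * al) / 4))
  (TrigMono (unit_mode i) (sin (2 * pi * al) / 4) ((1 - cos (2 * pi * al)) / 4)).
congr trig_poly; apply/funext => x.
by rewrite /trig_mono phase_unit_mode /coord_step; field.
Qed.

(** Thanks to the division by 4 each of the two terms has absolute value at most 1/2. The interval
    is the one on which [stepn] is controlled. *)
Lemma coord_step_itv i al x : -1 <= coord_step i al x <= 1.
Proof.
rewrite /coord_step; set t := 2 * pi * coord i x; set s := 2 * pi * al.
have aux (p q : R) : -1 <= sin p * (1 - cos q) / 2 <= 1.
  have /andP[c0 c2] : 0 <= (1 - cos q) / 2 <= 1.
    by have := cos_geN1 q; have := cos_le1 q; lra.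
  by rewrite -mulrA -ler_norml normrM mulr_ile1// ?sin_max// ger0_norm.
have := aux t s; have := aux s t; lra.
Qed.

(** Here p, q stand for cos, sin of pi y and r, s for cos, sin of pi al. The left side is
    [coord_step] after the double-angle formulas, and the last factor on the right is sin (pi (al -
    y)). *)
Lemma half_angle (p q r s : R) :
  (p * q *+ 2 * (1 - ((1 - s ^+ 2) *+ 2 - 1))
   - r * s *+ 2 * (1 - ((1 - q ^+ 2) *+ 2 - 1))) / 4 =
  q * s * (s * p - r * q).
Proof. by rewrite !mulr2n; lra. Qed.

Lemma coord_step_gt0 i al x : 0 < al < 1 -> 0 < coord i x < 1 ->
  (0 < coord_step i al x) = (coord i x < al).
Proof.
move=> al01; rewrite /coord_step; set y := coord i x => y01.
have -> : 2 * pi * y = (pi * y) *+ 2 by rewrite -mulr_natl; ring.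
have -> : 2 * pi * al = (pi * al) *+ 2 by rewrite -mulr_natl; ring.
rewrite !sin_mulr2n !cos_mulr2n.
set cx := cos (pi * y); set sx := sin (pi * y).
set ca := cos (pi * al); set sa := sin (pi * al).
have e1 : cx ^+ 2 = 1 - sx ^+ 2 by rewrite -(cos2Dsin2 (pi * y)) addrK.
have e2 : ca ^+ 2 = 1 - sa ^+ 2 by rewrite -(cos2Dsin2 (pi * al)) addrK.
have pi0 : 0 < pi :> R by exact: pi_gt0.
have sx0 : 0 < sx by apply: sin_gt0_pi; nra.
have sa0 : 0 < sa by apply: sin_gt0_pi; nra.
rewrite e1 e2 half_angle.
rewrite -sinB pmulr_rgt0 ?mulr_gt0//.
have [yal|aly|->] := ltgtP y al.
- by apply: sin_gt0_pi; nra.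
- apply/negbTE; rewrite -leNgt -oppr_ge0 -sinN ltW//.
  by apply: sin_gt0_pi; nra.
- by rewrite subrr sin0 ltxx.
Qed.

Lemma coord_step_approx i al : exists w : nat -> T -> R,
  [/\ forall k, trig_poly (w k), forall k x, `|w k x| <= 1 &
      forall x, 0 < coord i x < 1 ->
        w k x @[k --> \oo] --> ((coord i x < al)%R%:R : R)].
Proof.
(* For [al] outside ]0, 1[ the indicator is constant on the open unit square, and a constant
   sequence does. *)
have [al0|al0] := leP al 0.
  exists (fun _ _ => 0); split=> [_|_ x|x /andP[x0 _]].
  - exact: trig_poly_cst.
  - by rewrite normr0.
  - by rewrite ltNge (le_trans al0 (ltW x0)); exact: cvg_cst.
have [al1|al1] := leP 1 al.
  exists (fun _ _ => 1); split=> [_|_ x|x /andP[_ x1]].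
  - exact: trig_poly_cst.
  - by rewrite normr1.
  - by rewrite (lt_le_trans x1 al1); exact: cvg_cst.
exists (fun k x => stepn k (coord_step i al x)); split=> [k|k x|x x01].
- exact/trig_poly_stepn/trig_poly_coord_step.
- have /andP[? ?] := stepn_itv k (coord_step_itv i al x).
  by rewrite ger0_norm.
- have <- := coord_step_gt0 (introT andP (conj al0 al1)) x01.
  exact/cvg_stepn/coord_step_itv.
Qed.

End TrigonometricPolynomials.

(** * Functions orthogonal to all trigonometric polynomials *)

Section Completeness.
Variable R : realType.
Local Notation T := (measurableTypeR R * measurableTypeR R)%type.
Local Notation mu := (torus_measure R).

(** The density lives on the closed interval, so only the two endpoints matter, and a countable set
    is Lebesgue null. *)
Lemma uniform_prob01_endpoints : uniform_prob (@ltr01 R) (~` `]0, 1[) = 0%E.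
Proof.
rewrite /uniform_prob integral_uniform_pdf; apply: null_set_integral.
- by apply: measurableI => //; exact: measurableC.
- apply/measurable_EFinP; apply: measurable_funTS.
  exact: measurable_uniform_pdf.
- apply: countable_lebesgue_measure0.
  apply: (@sub_countable _ _ _ [set 0; 1 : R]); last exact: finite_set_countable.
  apply: subset_card_le => x [/= /negP + /itvP x01].
  rewrite in_itv/= negb_and -!leNgt => /orP[x0|x1].
    by left; apply/eqP; rewrite eq_le x0 x01.
  by right; apply/eqP; rewrite eq_le x1 x01.
Qed.

Lemma ae_open_square :
  \forall x \ae mu, [set x : T | forall i, 0 < coord i x < 1] x.
Proof.
have mN : measurable (~` `]0, 1[ : set (measurableTypeR R)).
  exact: measurableC.
exists ((~` `]0, 1[) `*` setT `|` setT `*` (~` `]0, 1[)); split.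
- by apply: measurableU; exact: measurableX.
- apply: (@null_set_setU _ _ _ mu); try exact: measurableX.
  + rewrite -[LHS]/((_ \x _)%E _) product_measure1E//.
    by rewrite [X in (X * _)%E](uniform_prob01_endpoints) mul0e.
  + rewrite -[LHS]/((_ \x _)%E _) product_measure1E//.
    by rewrite [X in (_ * X)%E](uniform_prob01_endpoints) mule0.
- move=> x /= /existsNP[i xi]; case: i xi => xi; [right|left]; split=> //=;
    by rewrite in_itv.
Qed.

Variable f : T -> R.
Hypothesis fi : mu.-integrable setT (EFin \o f).

Let mf : measurable_fun setT f.
Proof. by apply/measurable_EFinP; case/integrableP: fi. Qed.

(** Dominated convergence with majorant |f|. *)
Lemma integral_limit_eq0 (w : nat -> T -> R) (v : T -> R) :
  (forall k, measurable_fun setT (w k)) -> measurable_fun setT v ->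
  (forall k x, `|w k x| <= 1) ->
  (\forall x \ae mu, w k x @[k --> \oo] --> v x) ->
  (forall k, \int[mu]_x (f x * w k x)%:E = 0)%E ->
  (\int[mu]_x (f x * v x)%:E = 0)%E.
Proof.
move=> mw mv w1 wv w0.
have := @dominated_convergence _ _ _ mu setT measurableT
  (fun k x => (f x * w k x)%:E) (fun x => (f x * v x)%:E)
  (fun x => `|(f x)%:E|%E).
case.
- by move=> k; apply/measurable_EFinP; exact: measurable_funM.
- by apply/measurable_EFinP; exact: measurable_funM.
- apply: filterS wv => x wvx _; apply: cvg_EFin; first exact: nearW.
  by apply: cvgM => //; exact: cvg_cst.
- exact: integrable_abse.
- apply: nearW => x k _; rewrite /= lee_fin normrM.
  by rewrite ler_piMr.
move=> _ _; rewrite (_ : (fun k => _) = fun=> 0%E); last first.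
  by apply/funext => k; rewrite w0.
by move=> /cvg_lim <-//; rewrite lim_cst.
Qed.

Lemma integral_trig_poly_eq0 :
  (forall n a b, \int[mu]_x (f x * trig_mono n a b x)%:E = 0)%E ->
  forall u, trig_poly u -> (\int[mu]_x (f x * u x)%:E = 0)%E.
Proof.
move=> f0 u; elim=> [n a b|{}u v tu IHu tv IHv]; first exact: f0.
under eq_integral do rewrite mulrDr EFinD.
have [[M uM] [N vN]] := (bounded_trig_poly tu, bounded_trig_poly tv).
rewrite integralD//; last 2 first.
- exact: integrable_mul_bounded (measurable_trig_poly tu) uM.
- exact: integrable_mul_bounded (measurable_trig_poly tv) vN.
by rewrite [X in (X + _)%E]IHu [X in (_ + X)%E]IHv adde0.
Qed.

Definition quadrants : set (set T) :=
  [set E | exists a b : R, E = [set x | x.1 < a /\ x.2 < b]].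

Lemma quadrants_setI : setI_closed quadrants.
Proof.
move=> _ _ [a [b ->]] [a' [b' ->]]; exists (Num.min a a'), (Num.min b b').
apply/seteqP; split => x /=; rewrite !lt_min.
  by move=> [[-> ->] [-> ->]].
by move=> [/andP[-> ->] /andP[-> ->]].
Qed.

(** Letting one bound of a quadrant run through the naturals yields half planes; these make both
    projections measurable for the generated sigma-algebra, which then contains all measurable
    boxes. *)
Lemma measurable_quadrants : @measurable _ T = <<s quadrants >>.
Proof.
have mfst : measurable_fun (setT : set (g_sigma_algebraType quadrants))
    (fst : _ -> measurableTypeR R).
  apply: (measurability _ (RGenInftyO.measurableE R)).
  move=> _ [_ [a ->] <-]; rewrite setTI.
  have -> : fst @^-1` `]-oo, a[ =
      \bigcup_k ([set x | x.1 < a /\ x.2 < k%:R] : set T).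
    apply/seteqP; split => [x /=|x [k _ [/= + _]]]; rewrite in_itv//= => xa.
    by exists (Num.truncn x.2).+1 => //; split=> //; exact: truncnS_gt.
  apply: bigcupT_measurable => k; apply: sub_sigma_algebra.
  by exists a, k%:R.
have msnd : measurable_fun (setT : set (g_sigma_algebraType quadrants))
    (snd : _ -> measurableTypeR R).
  apply: (measurability _ (RGenInftyO.measurableE R)).
  move=> _ [_ [a ->] <-]; rewrite setTI.
  have -> : snd @^-1` `]-oo, a[ =
      \bigcup_k ([set x | x.1 < k%:R /\ x.2 < a] : set T).
    apply/seteqP; split => [x /=|x [k _ [/= _ +]]]; rewrite in_itv//= => xa.
    by exists (Num.truncn x.1).+1 => //; split=> //; exact: truncnS_gt.
  apply: bigcupT_measurable => k; apply: sub_sigma_algebra.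
  by exists k%:R, a.
apply/seteqP; split.
  rewrite measurable_prod_measurableType; apply: smallest_sub.
    exact: smallest_sigma_algebra.
  move=> _ [A mA [B mB <-]].
  rewrite (_ : A `*` B = fst @^-1` A `&` snd @^-1` B)//.
  apply: (@measurableI _ (g_sigma_algebraType quadrants)).
    by rewrite -[X in measurable X]setTI; exact: mfst.
  by rewrite -[X in measurable X]setTI; exact: msnd.
apply: smallest_sub; first exact: sigma_algebra_measurable.
move=> _ [a [b ->]].
rewrite (_ : [set _ | _] = `]-oo, a[%classic `*` `]-oo, b[%classic).
  exact: measurableX.
by apply/seteqP; split => x /=; rewrite !in_itv.
Qed.

Lemma trig_complete_real :
  (forall n a b, \int[mu]_x (f x * trig_mono n a b x)%:E = 0)%E ->
  \forall x \ae mu, f x = 0.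
Proof.
move=> /integral_trig_poly_eq0 f0.
(* [H] is the Dynkin class of the sets over which [f] integrates to 0. The indicator is kept as a
   factor so that [integral_limit_eq0] handles both the quadrants and increasing unions. *)
pose H := [set E : set T | measurable E /\
  (\int[mu]_x (f x * (\1_E x : R))%:E = 0)%E].
have QH : quadrants `<=` H.
  move=> _ [a [b ->]].
  have mE : measurable ([set x | x.1 < a /\ x.2 < b] : set T).
    by rewrite measurable_quadrants; apply: sub_sigma_algebra; exists a, b.
  split=> //.
  have [wa [twa wa1 wac]] := coord_step_approx false a.
  have [wb [twb wb1 wbc]] := coord_step_approx true b.
  have twab k := trig_polyM (twa k) (twb k).
  apply: (@integral_limit_eq0 (fun k x => wa k x * wb k x)).
  - by move=> k; exact: (measurable_trig_poly (twab k)).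
  - exact: measurable_indic.
  - by move=> k x; rewrite normrM mulr_ile1.
  - apply: filterS ae_open_square => x /= x01; rewrite indicE.
    rewrite (_ : _ \in _ = (x.1 < a) && (x.2 < b)).
      by rewrite -mulnb natrM; apply: cvgM; [exact: wac|exact: wbc].
    by apply/idP/andP => [/set_mem//|?]; exact: mem_set.
  - by move=> k; exact: f0 (twab k).
have HT : H setT.
  split=> //; rewrite -[RHS](f0 _ (trig_poly_cst 1)).
  by apply: eq_integral => x _; rewrite indicT.
have intE E : measurable E ->
    mu.-integrable setT (EFin \o (fun x => f x * (\1_E x : R))).
  move=> mE; apply: (@integrable_mul_bounded _ _ _ 1) => //.
  by move=> x; rewrite indicE; case: (_ \in _); rewrite ?normr1 ?normr0.
have lH : lambda_system setT H.
  split=> //.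
  - move=> A B BA [mA A0] [mB B0]; split; first exact: measurableD.
    have : (\int[mu]_x ((f x * \1_A x)%:E - (f x * \1_B x)%:E) = 0)%E.
      by rewrite integralB//; [rewrite A0 B0 sube0|exact: intE|exact: intE].
    move=> <-; apply: eq_integral => x _; rewrite -EFinB -mulrBr !indicE in_setD.
    case: (boolP (x \in B)) => [/set_mem /BA/mem_set ->|_].
      by rewrite subrr mulr0.
    by rewrite subr0 andbT.
  - move=> F ndF HF; split.
      by apply: bigcupT_measurable => k; case: (HF k).
    apply: (@integral_limit_eq0 (fun k => \1_(F k))).
    + by move=> k; apply: measurable_indic; case: (HF k).
    + by apply: measurable_indic; apply: bigcupT_measurable => k; case: (HF k).
    + by move=> k x; rewrite indicE; case: (_ \in _); rewrite ?normr1 ?normr0.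
    + apply: nearW => x; case: (pselect ((\bigcup_i F i) x)) => [Fx|nFx].
        rewrite indicE mem_set//; case: Fx => i _ Fix.
        apply: cvg_near_cst; exists i => // k /= ik.
        by rewrite indicE mem_set//; have /subsetPset := ndF _ _ ik; exact.
      rewrite indicE memNset//; apply: cvg_near_cst; apply: nearW => k.
      by rewrite indicE memNset// => Fkx; apply: nFx; exists k.
    + by move=> k; case: (HF k).
have mH E : measurable E -> H E.
  rewrite measurable_quadrants.
  by apply: (lambda_system_subset quadrants_setI lH QH).
have := @integral_ae_eq _ _ _ mu setT measurableT (fun=> 0%E) (EFin \o f) fi.
case=> [//|E _ mE|N [mN N0 sN]].
  rewrite integral0 integral_mkcond -[RHS](mH _ mE).2.
  apply: eq_integral => x _; rewrite patchE indicE.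
  by case: ifP => _; rewrite ?mulr1 ?mulr0.
exists N; split=> // x /= fx; apply: sN => /= /(_ I)[].
exact: fx.
Qed.

End Completeness.

(** * Complex integrals and the space L2 *)

Section ComplexIntegral.
Variable R : realType.
Local Notation T := (measurableTypeR R * measurableTypeR R)%type.
Local Notation mu := (torus_measure R).
Implicit Types (h w : T -> R[i]).

Definition cintegrable h :=
  mu.-integrable setT (EFin \o (fun x => complex.Re (h x))) /\
  mu.-integrable setT (EFin \o (fun x => complex.Im (h x))).

Lemma integrable_combination (a b : R) (u v : T -> R) :
  mu.-integrable setT (EFin \o u) -> mu.-integrable setT (EFin \o v) ->
  mu.-integrable setT (EFin \o (fun x => a * u x + b * v x)).
Proof.
by move=> iu iv; exact: integrableD (integrableZl _ _ iu) (integrableZl _ _ iv).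
Qed.

Lemma Rintegral_combination (a b : R) (u v : T -> R) :
  mu.-integrable setT (EFin \o u) -> mu.-integrable setT (EFin \o v) ->
  \int[mu]_x (a * u x + b * v x) = a * \int[mu]_x u x + b * \int[mu]_x v x.
Proof.
move=> iu iv; rewrite RintegralD ?RintegralZl//.
  exact: (integrableZl measurableT a iu).
exact: (integrableZl measurableT b iv).
Qed.

Lemma cintegrableD h w : cintegrable h -> cintegrable w ->
  cintegrable (fun x => h x + w x).
Proof.
move=> [h1 h2] [w1 w2]; split.
  have := integrable_combination 1 1 h1 w1.
  congr (_.-integrable _ _); apply/funext => x /=; congr (_%:E).
  by rewrite !mul1r; case: (h x); case: (w x).
have := integrable_combination 1 1 h2 w2.
congr (_.-integrable _ _); apply/funext => x /=; congr (_%:E).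
by rewrite !mul1r; case: (h x); case: (w x).
Qed.

Lemma cintegrableZ (a : R[i]) h : cintegrable h ->
  cintegrable (fun x => a * h x).
Proof.
case: a => a b [h1 h2]; split.
  have := integrable_combination a (- b) h1 h2.
  congr (_.-integrable _ _); apply/funext => x /=; congr (_%:E).
  by case: (h x) => ? ? /=; rewrite mulNr.
have := integrable_combination a b h2 h1.
congr (_.-integrable _ _); apply/funext => x /=; congr (_%:E).
by case: (h x) => ? ? /=.
Qed.

Lemma cintegralD h w : cintegrable h -> cintegrable w ->
  cintegral (fun x => h x + w x) = cintegral h + cintegral w.
Proof.
move=> [h1 h2] [w1 w2]; rewrite /cintegral.
have -> : (fun x => complex.Re (h x + w x)) =
    (fun x => complex.Re (h x) + complex.Re (w x)).
  by apply/funext => x; case: (h x); case: (w x).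
have -> : (fun x => complex.Im (h x + w x)) =
    (fun x => complex.Im (h x) + complex.Im (w x)).
  by apply/funext => x; case: (h x); case: (w x).
by rewrite !RintegralD.
Qed.

Lemma cintegralZ (a : R[i]) h : cintegrable h ->
  cintegral (fun x => a * h x) = a * cintegral h.
Proof.
case: a => a b [h1 h2]; rewrite /cintegral.
have -> : (fun x => complex.Re ((a +i* b) * h x)) =
    (fun x => a * complex.Re (h x) + (- b) * complex.Im (h x)).
  by apply/funext => x; case: (h x) => ? ? /=; rewrite mulNr.
have -> : (fun x => complex.Im ((a +i* b) * h x)) =
    (fun x => a * complex.Im (h x) + b * complex.Re (h x)).
  by apply/funext => x; case: (h x) => ? ? /=.
by rewrite !Rintegral_combination//; congr (_ +i* _); rewrite mulNr.
Qed.

Lemma ae_eq_Rintegral (u v : T -> R) :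
  mu.-integrable setT (EFin \o u) -> mu.-integrable setT (EFin \o v) ->
  (\forall x \ae mu, u x = v x) -> \int[mu]_x u x = \int[mu]_x v x.
Proof.
move=> iu iv uv; congr fine; apply: ae_eq_integral => //.
- by case/integrableP: iu.
- by case/integrableP: iv.
- by apply: filterS uv => x /= -> _.
Qed.

Lemma ae_eq_cintegral h w : cintegrable h -> cintegrable w ->
  (\forall x \ae mu, h x = w x) -> cintegral h = cintegral w.
Proof.
move=> [h1 h2] [w1 w2] hw; rewrite /cintegral; congr (_ +i* _).
  by apply: ae_eq_Rintegral => //; apply: filterS hw => x /= ->.
by apply: ae_eq_Rintegral => //; apply: filterS hw => x /= ->.
Qed.

(** The weights that can multiply every integrable function; all waves and all derivatives of test
    functions are of this kind. *)
Definition cbounded w := [/\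
  measurable_fun setT (fun x => complex.Re (w x)),
  measurable_fun setT (fun x => complex.Im (w x)) &
  exists M, forall x, `|complex.Re (w x)| <= M /\ `|complex.Im (w x)| <= M].

Lemma cintegrableM h w : cintegrable h -> cbounded w ->
  cintegrable (fun x => h x * w x).
Proof.
move=> [h1 h2] [mw1 mw2 [M wM]].
have w1 x : `|complex.Re (w x)| <= M by case: (wM x).
have w2 x : `|complex.Im (w x)| <= M by case: (wM x).
split.
  have := integrable_combination 1 (-1) (integrable_mul_bounded h1 mw1 w1)
    (integrable_mul_bounded h2 mw2 w2).
  congr (_.-integrable _ _); apply/funext => x /=; congr (_%:E).
  by case: (h x); case: (w x) => ? ? ? ? /=; rewrite mul1r mulN1r.
have := integrable_combination 1 1 (integrable_mul_bounded h1 mw2 w2)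
  (integrable_mul_bounded h2 mw1 w1).
congr (_.-integrable _ _); apply/funext => x /=; congr (_%:E).
by case: (h x); case: (w x) => ? ? ? ? /=; rewrite !mul1r.
Qed.

Lemma cbounded_real (u : R * R -> R) (M : R) : continuous u ->
  (forall x, `|u x| <= M) -> cbounded (fun x => (u x)%:C).
Proof.
move=> cu uM; split.
- exact: (continuous_measurable_prod cu).
- exact: (measurable_cst (0 : R)).
- by exists M => x /=; rewrite normr0; split=> //; exact: le_trans (uM x).
Qed.

Lemma cbounded_integrable w : cbounded w -> cintegrable w.
Proof.
move=> bw; have i1 : cintegrable (fun=> 1 : R[i]).
  split.
    by apply: (@bounded_integrable _ (fun=> 1) 1) => // x; rewrite normr1.
  by apply: (@bounded_integrable _ (fun=> 0) 0) => // x; rewrite normr0.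
have := cintegrableM i1 bw; congr cintegrable; apply/funext => x.
by rewrite mul1r.
Qed.

End ComplexIntegral.

(** * Classes of square integrable functions and their pairing with bounded weights *)

Section L2Space.
Variable R : realType.
Local Notation T := (measurableTypeR R * measurableTypeR R)%type.
Local Notation mu := (torus_measure R).
Local Notation L2 := (L2 R).
Implicit Types (f g : L2) (w : T -> R[i]).

Local Open Scope quotient_scope.

Lemma L2_pi_eqP (s t : sqintType R) :
  \pi_L2 s = \pi_L2 t <-> \forall x \ae mu, s x = t x.
Proof.
have -> : (\pi_L2 s = \pi_L2 t) <-> (s - t \in @ae0 R).
  by rewrite Quotient.idealrBE; split=> [->|/eqP].
rewrite inE /=; split; apply: filterS => x /=; rewrite !fctE.
  by move/eqP; rewrite subr_eq0 => /eqP.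
by move=> ->; rewrite subrr.
Qed.

Lemma L2_reprK (s : sqintType R) : \forall x \ae mu, repr (\pi_L2 s : L2) x = s x.
Proof. by apply/L2_pi_eqP; exact: reprK. Qed.

Lemma L2_eqP f g : f = g <-> \forall x \ae mu, repr f x = repr g x.
Proof.
rewrite -L2_pi_eqP -[f in f = g]reprK -[g in _ = g]reprK.
by [].
Qed.

Lemma L2_reprD f g : \forall x \ae mu, repr (f + g) x = repr f x + repr g x.
Proof.
have : \pi_L2 (repr f + repr g) = \pi_L2 (repr f) + \pi_L2 (repr g) :> L2.
  exact: (Quotient.pi_add (@ae0 R) (repr f) (repr g)).
by rewrite !reprK => <-; apply: filterS (L2_reprK (repr f + repr g)).
Qed.

Lemma L2_reprZ (a : R[i]) f : \forall x \ae mu, repr (a *: f) x = a * repr f x.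
Proof. exact: (L2_reprK (a *: repr f)). Qed.

Lemma L2_Lfun f : (fun x => complex.Re (repr f x)) \in Lfun mu 2%:E /\
  (fun x => complex.Im (repr f x)) \in Lfun mu 2%:E.
Proof. by have := valP (repr f); rewrite inE => /andP. Qed.

Lemma L2_cintegrable f : cintegrable (repr f).
Proof.
have [f1 f2] := L2_Lfun f.
have muT : mu setT \is a fin_num by rewrite torus_measureT.
by split; apply/Lfun1_integrable; exact: (Lfun_subset12 muT).
Qed.

Lemma L2_dot_cintegrable f g :
  cintegrable (fun x => repr f x * (repr g x)^*).
Proof.
have [f1 f2] := L2_Lfun f; have [g1 g2] := L2_Lfun g.
have i11 := (Lfun1_integrable _ _).1 (Lfun2_mul_Lfun1 f1 g1).
have i12 := (Lfun1_integrable _ _).1 (Lfun2_mul_Lfun1 f1 g2).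
have i21 := (Lfun1_integrable _ _).1 (Lfun2_mul_Lfun1 f2 g1).
have i22 := (Lfun1_integrable _ _).1 (Lfun2_mul_Lfun1 f2 g2).
split.
  have := integrable_combination 1 1 i11 i22.
  congr (_.-integrable _ _); apply/funext => x /=; congr (_%:E).
  by case: (repr f x); case: (repr g x) => ? ? ? ? /=;
    rewrite !mul1r mulrN opprK.
have := integrable_combination 1 (-1) i21 i12.
congr (_.-integrable _ _); apply/funext => x /=; congr (_%:E).
by case: (repr f x); case: (repr g x) => ? ? ? ? /=;
  rewrite mul1r mulN1r mulrN addrC.
Qed.

(** Bilinear, without conjugation, as in the weak formulation; the weight is a genuine function and
    not a class. *)
Definition pairing f w := cintegral (fun x => repr f x * w x).

Lemma pairing_cintegrable f w :
  cbounded w -> cintegrable (fun x => repr f x * w x).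
Proof. by move=> bw; exact: (cintegrableM (L2_cintegrable f) bw). Qed.

Lemma pairingD f g w : cbounded w ->
  pairing (f + g) w = pairing f w + pairing g w.
Proof.
move=> bw; have [fi gi] := (pairing_cintegrable f bw, pairing_cintegrable g bw).
rewrite /pairing -cintegralD//; apply: ae_eq_cintegral.
- exact: pairing_cintegrable.
- exact: cintegrableD.
- by apply: filterS (L2_reprD f g) => x /= ->; rewrite mulrDl.
Qed.

Lemma pairingZ a f w : cbounded w -> pairing (a *: f) w = a * pairing f w.
Proof.
move=> bw; have fi := pairing_cintegrable f bw.
rewrite /pairing -cintegralZ//; apply: ae_eq_cintegral.
- exact: pairing_cintegrable.
- exact: cintegrableZ.
- by apply: filterS (L2_reprZ a f) => x /= ->; rewrite mulrA.
Qed.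

Lemma pairing_combination f (a b : R[i]) w1 w2 : cbounded w1 -> cbounded w2 ->
  pairing f (fun x => a * w1 x + b * w2 x) =
  a * pairing f w1 + b * pairing f w2.
Proof.
move=> /(pairing_cintegrable f) i1 /(pairing_cintegrable f) i2.
rewrite /pairing -!cintegralZ// -cintegralD; try exact: cintegrableZ.
congr cintegral; apply/funext => x.
by rewrite mulrDr [in LHS](mulrCA _ a) [in LHS](mulrCA _ b).
Qed.

Lemma cbounded_sqint w : cbounded w -> (w : T -> R[i]^o) \in @sqint R.
Proof.
move=> [m1 m2 [M wM]]; have muT : (mu setT < +oo)%E by rewrite torus_measureT ltry.
have Lf (u : T -> R) : measurable_fun setT u -> (forall x, `|u x| <= M) ->
    u \in Lfun mu 2%:E.
  move=> mv uM.
  have M0 : 0 <= M by exact: le_trans (uM point).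
  apply/andP; split; rewrite inE//= /finite_norm unlock /Lnorm.
  rewrite poweR_lty//.
  have /integrableP[_] : mu.-integrable setT (EFin \o (fun x => u x ^+ 2)).
    apply: (@bounded_integrable _ _ (M ^+ 2)); first exact: measurable_funX.
    by move=> x; rewrite normrX lerXn2r ?nnegrE.
  congr (_ < _)%E; apply: eq_integral => x _ /=.
  by rewrite normrX powR_mulrn.
by rewrite inE /=; apply/andP; split; apply: Lf => // x; case: (wM x).
Qed.

Definition L2_of w (bw : cbounded w) : L2 := \pi_L2 (SqInt (cbounded_sqint bw)).

Lemma L2_of_repr w (bw : cbounded w) : \forall x \ae mu, repr (L2_of bw) x = w x.
Proof. exact: L2_reprK. Qed.

Lemma pairing_L2_of v w (bv : cbounded v) : cbounded w ->
  pairing (L2_of bv) w = cintegral (fun x => v x * w x).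
Proof.
move=> bw; apply: ae_eq_cintegral.
- exact: pairing_cintegrable.
- by apply: (cintegrableM _ bw); exact: cbounded_integrable.
- by apply: filterS (L2_of_repr bv) => x /= ->.
Qed.

End L2Space.

(** * Fourier coefficients and weak derivatives *)

Section Modes.
Variable R : realType.
Local Notation T := (measurableTypeR R * measurableTypeR R)%type.
Local Notation mu := (torus_measure R).
Local Notation L2 := (L2 R).
Implicit Types (n m : int * int) (x : R * R) (z : R[i]).

Definition wave n x : R[i] := cos (phase n x) +i* sin (phase n x).

(* Real waves are parametrised by a complex amplitude: differentiating then
   multiplies the amplitude by the symbol of the derivative. *)
Definition rwave n z x : R := complex.Re (z * wave n x).

Definition symbol1 (i : bool) n : R[i] :=
  (2 * pi * (if i then n.2 else n.1)%:~R)%:C * 'i.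
Definition symbol (s : seq bool) n : R[i] := \prod_(i <- s) symbol1 i n.

Lemma waveD n m x : wave (n + m) x = wave n x * wave m x.
Proof.
by rewrite /wave phaseD cosD sinD [X in _ +i* X]addrC.
Qed.

Lemma wave0 x : wave 0 x = 1.
Proof. by rewrite /wave phase0 cos0 sin0. Qed.

Lemma rwaveE n z x :
  rwave n z x = trig_mono n (complex.Re z) (- complex.Im z) x.
Proof. by case: z => a b; rewrite /rwave /trig_mono /= mulNr. Qed.

Lemma rwave_trig_mono n a b x : trig_mono n a b x = rwave n (a +i* (- b)) x.
Proof. by rewrite rwaveE /= opprK. Qed.

Lemma wave_rwave n x :
  wave n x = rwave n 1 x +i* rwave n (- 'i) x.
Proof.
rewrite /rwave mul1r /wave /=.
by rewrite oppr0 !mul0r sub0r mulN1r opprK.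
Qed.

Lemma symbol1N i n : symbol1 i (- n) = - symbol1 i n.
Proof.
by rewrite /symbol1; case: i => /=; rewrite mulrNz mulrN rmorphN mulNr.
Qed.

Lemma symbolN s n : symbol s (- n) = (-1) ^+ size s * symbol s n.
Proof.
elim: s => [|i s IH]; first by rewrite /symbol !big_nil expr0 mul1r.
rewrite /symbol !big_cons -/(symbol s n) -/(symbol s (- n)) IH symbol1N.
by rewrite /= exprS; ring.
Qed.

Lemma phase_line n i (t : R) x : phase n (t *: dir R i + x) =
  complex.Im (symbol1 i n) * t + phase n x.
Proof.
rewrite /phase /symbol1; case: i => /=; rewrite /GRing.scale /=; ring.
Qed.

Lemma is_derive_rwave n z i x :
  is_derive x (dir R i) (rwave n z) (rwave n (symbol1 i n * z) x).
Proof.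
apply/is_derive_line0P; set k := complex.Im (symbol1 i n).
have -> : (fun s : R => rwave n z (s *: dir R i + x)) =
    (complex.Re z \*: (cos \o (fun s : R => k * s + phase n x))) +
    ((- complex.Im z) \*: (sin \o (fun s : R => k * s + phase n x))).
  by apply/funext => s; rewrite rwaveE /trig_mono phase_line.
have dp : is_derive (0 : R) 1 (fun s : R => k * s + phase n x) k.
  have := is_deriveD (is_deriveZ k (is_derive_id (0 : R) (1 : R)))
    (is_derive_cst (phase n x) (0 : R) (1 : R)).
  by rewrite addr0 [_ *: _]mulr1.
have := is_deriveD
  (is_deriveZ (complex.Re z) (is_derive1_comp (is_derive_cos _) dp))
  (is_deriveZ (- complex.Im z) (is_derive1_comp (is_derive_sin _) dp)).
rewrite mulr0 add0r; congr is_derive; rewrite /rwave /wave.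
have -> : symbol1 i n = 0 +i* k.
  by rewrite /k /symbol1 /=; simpc.
by case: z => a b; rewrite /GRing.scale /=; ring.
Qed.

Lemma pderiv_rwave s n z : pderiv s (rwave n z) = rwave n (symbol s n * z).
Proof.
elim: s => [|i s IH] /=; first by rewrite /symbol big_nil mul1r.
rewrite -/(pderiv _ _) IH; apply/funext => x.
have := is_derive_rwave n (symbol s n * z) i x => dr.
by rewrite derive_val /symbol big_cons mulrA.
Qed.

Lemma continuous_rwave n z : continuous (rwave n z).
Proof.
have -> : rwave n z = trig_mono n (complex.Re z) (- complex.Im z).
  by apply/funext => x; rewrite rwaveE.
exact: continuous_trig_mono.
Qed.

Lemma rwave_bounded n z x :
  `|rwave n z x| <= `|complex.Re z| + `|complex.Im z|.
Proof. by rewrite rwaveE -[in leRHS](normrN (complex.Im z)) bounded_trig_mono. Qed.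

Lemma sincos_periodic_int (k : int) (t : R) :
  cos (t + 2 * pi * k%:~R) = cos t /\ sin (t + 2 * pi * k%:~R) = sin t.
Proof.
have aux (j : nat) (u : R) :
    cos (u + 2 * pi * j%:R) = cos u /\ sin (u + 2 * pi * j%:R) = sin u.
  have -> : 2 * pi * j%:R = (pi *+ 2) *+ j :> R.
    by rewrite -[RHS]mulr_natr -[pi *+ 2]mulr_natl.
  by rewrite (periodicn (@cosD2pi R)) (periodicn (@sinD2pi R)).
case: k => j; first exact: aux.
have [c s] := aux j.+1 (t + 2 * pi * (Negz j)%:~R).
by move: c s; rewrite NegzE mulrNz mulrN subrK => -> ->.
Qed.

Lemma wave_periodic n i x : wave n (x + dir R i) = wave n x.
Proof.
have := phase_line n i 1 x; rewrite scale1r mulr1 (addrC (dir R i)).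
rewrite (addrC (complex.Im _)) /wave => ->.
have -> : complex.Im (symbol1 i n) = 2 * pi * (if i then n.2 else n.1)%:~R.
  by rewrite /symbol1 /=; ring.
by have [-> ->] := sincos_periodic_int (if i then n.2 else n.1) (phase n x).
Qed.

Lemma test_function_rwave n z : test_function (rwave n z).
Proof.
split=> [i x|s x]; first by rewrite /rwave wave_periodic.
rewrite pderiv_rwave; split; first exact: continuous_rwave.
by move=> i; have [] := is_derive_rwave n (symbol s n * z) i x.
Qed.

Lemma cbounded_wave n : cbounded (wave n).
Proof.
split.
- have E : (fun x => complex.Re (wave n x)) = rwave n 1.
    by apply/funext => x; rewrite wave_rwave.
  by have := continuous_measurable_prod (@continuous_rwave n 1); rewrite -E.
- have E : (fun x => complex.Im (wave n x)) = rwave n (- 'i).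
    by apply/funext => x; rewrite wave_rwave.
  by have := continuous_measurable_prod (@continuous_rwave n (- 'i)); rewrite -E.
- by exists 1 => x; split; [exact: cos_max|exact: sin_max].
Qed.

Lemma cbounded_rwave n z : cbounded (fun x => (rwave n z x)%:C).
Proof.
exact: (@cbounded_real _ (rwave n z) _ (@continuous_rwave n z)
  (rwave_bounded n z)).
Qed.

Definition mode n : L2 := L2_of (cbounded_wave n).

(** The Fourier coefficient: [wave (- n)] is the conjugate of [wave n], which the bilinear [pairing]
    does not supply. *)
Definition coef n (f : L2) : R[i] := pairing f (wave (- n)).

Lemma coefD n f g : coef n (f + g) = coef n f + coef n g.
Proof. exact/pairingD/cbounded_wave. Qed.

Lemma coefZ n a f : coef n (a *: f) = a * coef n f.
Proof. exact/pairingZ/cbounded_wave. Qed.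

Lemma coef0 n : coef n 0 = 0.
Proof. by rewrite -(scale0r (0 : L2)) coefZ mul0r. Qed.

Lemma coefN n f : coef n (- f) = - coef n f.
Proof. by rewrite -scaleN1r coefZ mulN1r. Qed.

Lemma coef_sum (I : finType) n (F : I -> L2) :
  coef n (\sum_i F i) = \sum_i coef n (F i).
Proof.
by elim/big_rec2: _ => [|i y x _ <-]; [exact: coef0|rewrite coefD].
Qed.

Lemma rwave_wave n z x :
  (rwave n z x)%:C = z / 2 * wave n x + z^* / 2 * wave (- n) x.
Proof.
rewrite /rwave /wave phaseN cosN sinN.
have two : 2 = (2 : R)%:C by rewrite rmorph_nat.
rewrite two -!fmorphV; case: z => a b; rewrite /=; simpc.
by congr (_ +i* _); lra.
Qed.

(** A real wave is a combination of [wave n] and [wave (- n)], so [f] is orthogonal to all real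
    waves; real completeness then applies to the real and imaginary parts of [f] separately. *)
Lemma coef_eq0 f : (forall n, coef n f = 0) -> f = 0.
Proof.
move=> f0; have [if1 if2] := L2_cintegrable f.
have pr n z : pairing f (fun x => (rwave n z x)%:C) = 0.
  have -> : (fun x => (rwave n z x)%:C) =
      (fun x => z / 2 * wave n x + z^* / 2 * wave (- n) x).
    by apply/funext => x; exact: rwave_wave.
  rewrite pairing_combination; try exact: cbounded_wave.
  by have := f0 (- n); rewrite /coef opprK => ->; have := f0 n; rewrite /coef => ->;
    rewrite !mulr0 addr0.
(* [Rintegral] sends infinite integrals to 0; integrability is what lifts its vanishing back to the
   extended reals. *)
have fin (u : T -> R) n a b : mu.-integrable setT (EFin \o u) ->
    \int[mu]_x (u x * trig_mono n a b x) = 0 ->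
    (\int[mu]_x (u x * trig_mono n a b x)%:E = 0)%E.
  move=> iu; rewrite /Rintegral => u0; rewrite -[LHS]fineK ?u0//.
  apply: integrable_fin_num => //.
  exact: integrable_mul_bounded iu (measurable_trig_poly (TrigMono n a b))
    (bounded_trig_mono n a b).
have f1 : \forall x \ae mu, complex.Re (repr f x) = 0.
  apply: (trig_complete_real if1) => n a b; apply: fin => //.
  have /(congr1 (@complex.Re R)) /= := pr n (a +i* (- b)).
  move=> p0; rewrite -[RHS]p0; apply: eq_Rintegral => x _.
  by rewrite rwave_trig_mono; case: (repr f x) => ? ? /=; rewrite mulr0 subr0.
have f2 : \forall x \ae mu, complex.Im (repr f x) = 0.
  apply: (trig_complete_real if2) => n a b; apply: fin => //.
  have /(congr1 (@complex.Im R)) /= := pr n (a +i* (- b)).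
  move=> p0; rewrite -[RHS]p0; apply: eq_Rintegral => x _.
  by rewrite rwave_trig_mono; case: (repr f x) => ? ? /=; rewrite mulr0 add0r.
apply/L2_eqP; have := L2_reprZ 0 (0 : L2); rewrite scale0r.
move: f1 f2; apply: filterS3 => x /= + + ->; rewrite mul0r.
by case: (repr f x) => ? ? /= -> ->.
Qed.

Lemma coef_inj f g : (forall n, coef n f = coef n g) -> f = g.
Proof.
move=> fg; apply/eqP; rewrite -subr_eq0; apply/eqP/coef_eq0 => n.
by rewrite coefD coefN fg subrr.
Qed.

Lemma coef_weak_deriv s f g n :
  is_weak_deriv s f g -> coef n g = symbol s n * coef n f.
Proof.
(* Test functions are real, so the complex wave is split as w = Re w + i Re (- i w), that is, into
   real waves of amplitudes [c] and [- 'i * c]. *)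
move=> wd; have split_wave c h : pairing h (fun x => c * wave (- n) x) =
    pairing h (fun x => (rwave (- n) c x)%:C) +
    'i * pairing h (fun x => (rwave (- n) (- 'i * c) x)%:C).
  have := pairing_combination h 1 'i (cbounded_rwave (- n) c)
    (cbounded_rwave (- n) (- 'i * c)).
  rewrite mul1r => <-; congr pairing; apply/funext => x.
  rewrite mul1r /rwave -mulrA; case: (c * _) => a b; simpc.
  by congr (_ +i* _); lra.
have wdz z : pairing f (fun x => (rwave (- n) (symbol s (- n) * z) x)%:C) =
    (-1) ^+ size s * pairing g (fun x => (rwave (- n) z x)%:C).
  by have := wd _ (test_function_rwave (- n) z); rewrite pderiv_rwave.
have fs : pairing f (fun x => symbol s (- n) * wave (- n) x) =
    symbol s (- n) * coef n f.
  have := pairing_combination f (symbol s (- n)) 0 (cbounded_wave (- n))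
    (cbounded_wave (- n)).
  rewrite mul0r addr0 => <-; congr pairing; apply/funext => x.
  by rewrite mul0r addr0.
have g1 : coef n g = pairing g (fun x => 1 * wave (- n) x).
  by congr pairing; apply/funext => x; rewrite mul1r.
have : symbol s (- n) * coef n f = (-1) ^+ size s * coef n g.
  rewrite -fs split_wave g1 split_wave mulrDr -wdz.
  rewrite [- 'i * symbol _ _]mulrC -{1}[symbol s (- n)]mulr1; congr (_ + _).
  by rewrite wdz mulr1 mulrCA.
(* The sign in the weak formulation cancels against the sign from passing to frequency [- n]. *)
rewrite symbolN -mulrA => /(congr1 (fun t => (-1) ^+ size s * t)).
by rewrite !mulrA -exprMn mulrNN mulr1 expr1n !mul1r => ->.
Qed.

End Modes.

(** * Integration by parts and weak derivatives of the modes *)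

Section WeakDerivatives.
Variable R : realType.
Local Notation T := (measurableTypeR R * measurableTypeR R)%type.
Local Notation mu := (torus_measure R).
Local Notation L2 := (L2 R).
Implicit Types (n m : int * int) (x : R * R) (z : R[i]) (phi : R * R -> R)
  (f g : L2).

Lemma continuous_pderiv s phi : test_function phi -> continuous (pderiv s phi).
Proof. by move=> [_ +] x => /(_ s x)[]. Qed.

Lemma derivable_pderiv s phi i x : test_function phi ->
  derivable (pderiv s phi) x (dir R i).
Proof. by move=> [_ /(_ s x)[_]]. Qed.

Lemma periodic_pderiv s phi i x : test_function phi ->
  pderiv s phi (x + dir R i) = pderiv s phi x.
Proof.
move=> [phiP _]; elim: s i x => [|j s IH] i x; first exact: phiP.
rewrite /= -/(pderiv s phi) /derive.
suff -> : (fun h : R => h^-1 *: ((pderiv s phi \o shift (x + dir R i))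
      (h *: dir R j) - pderiv s phi (x + dir R i))) =
    (fun h : R => h^-1 *: ((pderiv s phi \o shift x) (h *: dir R j)
      - pderiv s phi x)) by [].
by apply/funext => h /=; rewrite addrA !IH.
Qed.

Lemma bounded_pderiv s phi : test_function phi ->
  exists M, forall x, `|pderiv s phi x| <= M.
Proof.
move=> tphi; apply: periodic_bounded; first exact: continuous_pderiv.
by move=> i x; exact: periodic_pderiv.
Qed.

Lemma rwaveN n z x : rwave n (- z) x = - rwave n z x.
Proof. by rewrite /rwave mulNr; case: (z * _). Qed.

(** The difference of the two sides is the integral of the [i]-th derivative of the periodic product
    [rwave n z * pderiv s phi]. *)
Lemma rwave_by_parts n z i s phi : test_function phi ->
  \int[mu]_x (rwave n z x * pderiv (i :: s) phi x) =
  \int[mu]_x (rwave n (- symbol1 R i n * z) x * pderiv s phi x).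
Proof.
move=> tphi; apply/eqP; rewrite -subr_eq0; apply/eqP.
have [M bM] := @bounded_pderiv s _ tphi.
have [N bN] := @bounded_pderiv (i :: s) _ tphi.
set psi := pderiv s phi in bM *; set psi' := pderiv (i :: s) phi in bN *.
have int (u v : R * R -> R) (A B : R) : continuous u -> continuous v ->
    (forall x, `|u x| <= A) -> (forall x, `|v x| <= B) ->
    mu.-integrable setT (EFin \o (fun x => u x * v x)).
  move=> cu cv bu bv; apply: (@bounded_integrable _ _ (A * B)).
    apply: continuous_measurable_prod => x.
    by apply: cvgM; [exact: cu|exact: cv].
  by move=> x; rewrite normrM ler_pM.
have D x : is_derive x (dir R i) (rwave n z * psi)
    (rwave n z x * psi' x - rwave n (- symbol1 R i n * z) x * psi x).
  have := is_deriveM (is_derive_rwave n z i x)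
    (derivableP (@derivable_pderiv s _ i x tphi)).
  by rewrite mulNr rwaveN mulNr opprK [X in _ + X]mulrC.
rewrite -RintegralB//; last 2 first.
- exact: int (@continuous_rwave _ n z) (@continuous_pderiv (i :: s) _ tphi)
    (rwave_bounded n z) bN.
- exact: int (@continuous_rwave _ n _) (@continuous_pderiv s _ tphi)
    (rwave_bounded n _) bM.
have DE : (fun x => 'D_(dir R i) (rwave n z * psi) x) = (fun x =>
    rwave n z x * psi' x - rwave n (- symbol1 R i n * z) x * psi x).
  by apply/funext => x; rewrite derive_val.
have := @integral_pderiv_eq0 R i (rwave n z * psi)
  ((`|complex.Re z| + `|complex.Im z|) * N +
   (`|complex.Re (- symbol1 R i n * z)| + `|complex.Im (- symbol1 R i n * z)|) * M).
rewrite DE; apply.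
- by move=> x; case: (D x).
- move=> x; apply: cvgB; apply: cvgM; try exact: continuous_rwave.
    exact: (@continuous_pderiv (i :: s) _ tphi).
  exact: (@continuous_pderiv s _ tphi).
- move=> x; rewrite derive_val (le_trans (ler_normB _ _))// !normrM.
  by rewrite lerD// ler_pM// rwave_bounded.
- move=> x; rewrite /= !fctE /psi (@periodic_pderiv s _ i x tphi).
  by rewrite /rwave wave_periodic.
Qed.

Lemma cintegrable_wave_test n s phi : test_function phi ->
  cintegrable (fun x => wave n x * (pderiv s phi x)%:C).
Proof.
move=> tphi; have [M bM] := @bounded_pderiv s _ tphi.
apply: cintegrableM; first exact/cbounded_integrable/cbounded_wave.
exact: cbounded_real (@continuous_pderiv s _ tphi) bM.
Qed.

(** The real version is used twice: amplitude 1 gives the real part of the wave, amplitude [- 'i]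
    the imaginary part. *)
Lemma wave_by_parts n i s phi : test_function phi ->
  cintegral (fun x => wave n x * (pderiv (i :: s) phi x)%:C) =
  - symbol1 R i n * cintegral (fun x => wave n x * (pderiv s phi x)%:C).
Proof.
move=> tphi; rewrite -cintegralZ; last exact: cintegrable_wave_test.
have ReE z w (r : R) : complex.Re (z * (w * r%:C)) = complex.Re (z * w) * r.
  by rewrite mulrA; case: (z * w) => ? ? /=; rewrite mulr0 subr0.
have ImE (w : R[i]) : complex.Im w = complex.Re (- 'i * w).
  by case: w => ? ? /=; rewrite oppr0 mul0r mulN1r opprK add0r.
have IE (u v : T -> R) : u =1 v -> \int[mu]_x u x = \int[mu]_x v x.
  by move=> uv; congr Rintegral; apply/funext.
rewrite /cintegral; congr (_ +i* _).
  transitivity (\int[mu]_x (rwave n 1 x * pderiv (i :: s) phi x)).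
    by apply: IE => x; rewrite -(ReE 1) mul1r.
  by rewrite rwave_by_parts// mulr1; apply: IE => x; rewrite -ReE.
transitivity (\int[mu]_x (rwave n (- 'i) x * pderiv (i :: s) phi x)).
  by apply: IE => x; rewrite ImE ReE.
rewrite rwave_by_parts//; apply: IE => x.
by rewrite ImE (mulrA (- 'i)) ReE /rwave (mulrC (- 'i) (- symbol1 R i n)).
Qed.

Lemma wave_weak_deriv n s phi : test_function phi ->
  cintegral (fun x => wave n x * (pderiv s phi x)%:C) =
  (-1) ^+ size s * symbol R s n * cintegral (fun x => wave n x * (phi x)%:C).
Proof.
move=> tphi; elim: s => [|i s IH].
  by rewrite /symbol big_nil expr0 !mul1r.
by rewrite wave_by_parts// IH /symbol big_cons /= exprS; ring.
Qed.

Lemma weak_deriv_mode n s : is_weak_deriv s (mode R n) (symbol R s n *: mode R n).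
Proof.
move=> phi tphi; have [M bM] := @bounded_pderiv [::] _ tphi.
have [N bN] := @bounded_pderiv s _ tphi.
have b0 : cbounded (fun x => (phi x)%:C).
  exact: cbounded_real (@continuous_pderiv [::] _ tphi) bM.
have bs : cbounded (fun x => (pderiv s phi x)%:C).
  exact: cbounded_real (@continuous_pderiv s _ tphi) bN.
have := pairingZ (symbol R s n) (mode R n) b0; rewrite /pairing => ->.
have := pairing_L2_of (cbounded_wave R n) bs; rewrite /pairing => ->.
have := pairing_L2_of (cbounded_wave R n) b0; rewrite /pairing => ->.
by rewrite wave_weak_deriv// mulrA.
Qed.

(** Two weak derivatives of [f] share all Fourier coefficients, hence coincide; the value chosen by
    [xget] is thus determined. *)
Lemma weak_derivP s f g : is_weak_deriv s f g -> weak_deriv s f = g.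
Proof.
move=> wd; rewrite /weak_deriv.
have wd' : is_weak_deriv s f (xget 0 [set g | is_weak_deriv s f g]).
  by have := @xgetI _ 0 [set g | is_weak_deriv s f g] g wd.
by apply: coef_inj => n; rewrite (coef_weak_deriv n wd) (coef_weak_deriv n wd').
Qed.

Lemma coef_weak_derivE s f n : H2 f -> (size s <= 2)%N ->
  coef n (weak_deriv s f) = symbol R s n * coef n f.
Proof.
move=> /(_ s) /[apply] -[g wd].
by rewrite (weak_derivP wd) (coef_weak_deriv n wd).
Qed.

Lemma H2_mode n : H2 (mode R n).
Proof. by move=> s _; exists (symbol R s n *: mode R n); exact: weak_deriv_mode. Qed.

(** Off the diagonal no integral is computed: integrating by parts against the constant test
    function 1, written [rwave 0 1], gives symbol times integral = 0, and in some direction the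
    symbol of [m - n] is nonzero. *)
Lemma coef_mode n m : coef n (mode R m) = (n == m)%:R.
Proof.
rewrite /coef /mode pairing_L2_of; last exact: cbounded_wave.
have -> : (fun x => wave m x * wave (- n) x) = @wave R (m - n).
  by apply/funext => x; rewrite waveD.
have t1 : test_function (@rwave R 0 1) by exact: test_function_rwave.
have E1 (x : R * R) : rwave 0 1 x = 1 by rewrite /rwave wave0 mulr1.
have wE (k : int * int) : (fun x => wave k x * (rwave 0 1 x)%:C) = @wave R k.
  by apply/funext => x; rewrite E1 mulr1.
case: eqVneq => [->|nm].
  have -> : @wave R (m - m) = fun=> 1.
    by apply/funext => x; rewrite subrr wave0.
  have muT : fine (torus_measure R setT) = 1 by rewrite torus_measureT.
  by rewrite /cintegral /= !Rintegral_cst// [fine _]muT mulr1 mul0r.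
have [i ki] : exists i : bool, symbol1 R i (m - n) != 0.
  have pi0 : (2 * pi : R) != 0 by rewrite mulf_neq0// ?gt_eqF// ?pi_gt0.
  have : (m.1 != n.1) || (m.2 != n.2).
    rewrite -negb_and; apply: contra nm; case: (m) (n) => [m1 m2] [n1 n2] /=.
    by move=> /andP[/eqP -> /eqP ->].
  move=> /orP[h|h]; [exists false|exists true]; rewrite /symbol1 /=;
    rewrite mulf_neq0 ?neq0Ci// fmorph_eq0 mulf_neq0// intr_eq0 subr_eq0.
    exact: h.
  exact: h.
have := wave_by_parts (m - n) i [::] t1; rewrite /= wE.
have -> : (fun x => wave (m - n) x * ('D_(dir R i) (rwave 0 1) x)%:C) = fun=> 0.
  apply/funext => x; have := is_derive_rwave 0 1 i x => dr.
  rewrite derive_val /rwave /symbol1 (_ : (if i then _ else _) = 0); last by case: (i).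
  by rewrite mulr0 rmorph0 !mul0r /= mulr0.
rewrite /cintegral /= !Rintegral_cst// !mul0r => /esym/eqP.
by rewrite mulf_eq0 oppr_eq0 (negbTE ki) /= => /eqP.
Qed.

End WeakDerivatives.

(** * The spectrum of the diagonal operator *)

Section Spectrum.
Variables (R : realType) (a b : R) (k : R * R).
Hypothesis a_gt0 : 0 < a.
Local Notation L2 := (L2 R).
Local Notation A := (A_op a b k).
Implicit Types (n m : int * int) (f g : L2) (z : R[i]).

Definition energy n : R :=
  a^-1 * ((2 * pi * n.1%:~R + k.1) ^+ 2 + (2 * pi * n.2%:~R + k.2) ^+ 2) + b / a.

(** The shape of A_k with opaque summands in place of the weak derivatives, so that linearity is
    unfolded once without touching them. *)
Let coef_linear n (x y p q r t c1 c2 c3 c4 : R[i]) (f1 f2 f3 f4 f : L2) :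
  coef n f1 = c1 -> coef n f2 = c2 -> coef n f3 = c3 -> coef n f4 = c4 ->
  coef n (- (x *: (f1 + f2 + y *: (p *: f3 + q *: f4) - r *: f)) + t *: f) =
  - (x * (c1 + c2 + y * (p * c3 + q * c4) - r * coef n f)) + t * coef n f.
Proof.
move=> <- <- <- <-; rewrite coefD coefN coefZ (coefD _ _ (- _)) coefN !coefZ.
by rewrite (coefD _ (_ + _)) (coefD _ f1) coefZ (coefD _ (_ *: _)) !coefZ.
Qed.

Lemma coef_A_op n f : H2 f -> coef n (A f) = (energy n)%:C * coef n f.
Proof.
move=> Hf; apply: etrans.
  by apply: coef_linear; exact: coef_weak_derivE.
(* The symbol of Delta_k is -(|2 pi n|^2 + 2 <k, 2 pi n> + |k|^2) = -|2 pi n + k|^2. *)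
rewrite /symbol !big_cons !big_nil /symbol1 /energy.
case: (coef n f) => u v; apply/eqP; rewrite eq_complex /=.
by apply/andP; split; apply/eqP; ring.
Qed.

Lemma H2_linear (x : R[i]) f g : H2 f -> H2 g -> H2 (x *: f + g).
Proof.
move=> Hf Hg s s2; have [f' wf] := Hf s s2; have [g' wg] := Hg s s2.
exists (x *: f' + g') => phi tphi.
have [M bM] := @bounded_pderiv _ [::] _ tphi.
have [N bN] := @bounded_pderiv _ s _ tphi.
have b0 : cbounded (fun x => (phi x)%:C).
  exact: cbounded_real (@continuous_pderiv _ [::] _ tphi) bM.
have bs : cbounded (fun x => (pderiv s phi x)%:C).
  exact: cbounded_real (@continuous_pderiv _ s _ tphi) bN.
have := pairingD (x *: f) g bs; rewrite pairingZ// /pairing => ->.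
have := pairingD (x *: f') g' b0; rewrite pairingZ// /pairing => ->.
by rewrite (wf _ tphi) (wg _ tphi); ring.
Qed.

Lemma H2_0 : H2 (0 : L2).
Proof.
have := H2_linear (-1) (H2_mode R 0) (H2_mode R 0).
by rewrite scaleN1r addNr.
Qed.

Lemma H2_sum (I : finType) (x : I -> R[i]) (F : I -> L2) :
  (forall i, H2 (F i)) -> H2 (\sum_i x i *: F i).
Proof.
move=> HF; elim/big_ind: _ => [|f g Hf Hg|i _].
- exact: H2_0.
- by rewrite -[f]scale1r; exact: H2_linear.
- by rewrite -[_ *: _]addr0; apply: H2_linear => //; exact: H2_0.
Qed.

Lemma A_op_eigenP f z : H2 f ->
  A f = z *: f <-> forall n, (energy n)%:C != z -> coef n f = 0.
Proof.
move=> Hf; split=> [Af n nz|f0].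
  apply/eqP; have /eqP := congr1 (coef n) Af; rewrite coef_A_op// coefZ.
  by rewrite -subr_eq0 -mulrBl mulf_eq0 subr_eq0 (negbTE nz).
apply: coef_inj => n; rewrite coef_A_op// coefZ.
by case: (eqVneq (energy n)%:C z) => [->//|/f0 ->]; rewrite !mulr0.
Qed.

(** The modes with frequencies in [s] form a basis, Fourier coefficients being the coordinates; this
    equates geometric multiplicity with the number of frequencies at energy [z]. *)
Lemma eigen_space_A_op z (s : seq (int * int)) : uniq s ->
  (forall n, (n \in s) = ((energy n)%:C == z)) ->
  has_dim (eigen_space A z) (size s).
Proof.
move=> us sz; pose e (i : 'I_(size s)) := mode R (nth 0 s i).
have coef_e (x : 'I_(size s) -> R[i]) (i : 'I_(size s)) :
    coef (nth 0 s i) (\sum_j x j *: e j) = x i.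
  rewrite coef_sum (bigD1 i)//= big1 => [|j ji].
    by rewrite coefZ coef_mode eqxx mulr1 addr0.
  by rewrite coefZ coef_mode nth_uniq// eq_sym (inj_eq val_inj) (negbTE ji) mulr0.
have coef_out (x : 'I_(size s) -> R[i]) n :
    n \notin s -> coef n (\sum_j x j *: e j) = 0.
  move=> ns; rewrite coef_sum big1// => j _; rewrite coefZ coef_mode.
  by case: eqP ns => [->|_ _]; rewrite ?mem_nth// mulr0.
exists e; split=> [x x0 i|]; first by rewrite -(coef_e x) x0 coef0.
apply/seteqP; split => [f [Hf Af]|f [x ->]].
  exists (fun i => coef (nth 0 s i) f); apply: coef_inj => n.
  have [ns|ns] := boolP (n \in s).
    have ins : (index n s < size s)%N by rewrite index_mem.
    have := coef_e (fun i => coef (nth 0 s i) f) (Ordinal ins).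
    by rewrite /= nth_index.
  rewrite coef_out//; apply: ((A_op_eigenP z Hf).1 Af).
  by rewrite -sz.
have He : H2 (\sum_j x j *: e j) by apply: H2_sum => j; exact: H2_mode.
split=> //; apply/(A_op_eigenP z He) => n nz; apply: coef_out.
by rewrite sz.
Qed.

Lemma eigen_space_mode n : eigen_space A (energy n)%:C (mode R n).
Proof.
split; first exact: H2_mode.
apply/A_op_eigenP; first exact: H2_mode.
move=> m; rewrite coef_mode; case: (eqVneq m n) => [->|//].
by rewrite eqxx.
Qed.

Lemma mode_neq0 n : mode R n != 0.
Proof.
apply/eqP => /(congr1 (coef n)); rewrite coef_mode eqxx coef0 => /eqP.
by rewrite oner_eq0.
Qed.

Lemma sqr_int_unbounded (x y : R) : exists N : nat, forall j : int,
  (2 * pi * j%:~R + x) ^+ 2 <= y -> (`|j| <= N)%N.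
Proof.
(* If |j| > N, then |2 pi j + x| >= |j| - |x| > |y| + 1, whose square exceeds y. *)
pose N := Num.truncn (`|y| + 1 + `|x|).
exists N => j jy; rewrite leqNgt; apply/negP => Nj.
have jN : `|y| + 1 + `|x| < `|j%:~R : R|.
  rewrite -intr_norm -abszE; apply: lt_le_trans (truncnS_gt _) _.
  by rewrite pmulrn ler_int lez_nat.
have pi1 : 1 <= 2 * pi :> R by have := pi_ge2 R; lra.
have : `|j%:~R : R| <= `|2 * pi * j%:~R + x| + `|x|.
  apply: (@le_trans _ _ `|2 * pi * j%:~R|).
    by rewrite normrM ler_peMl// ger0_norm//; lra.
  by rewrite -[X in `|X| <= _](addrK x) (le_trans (ler_normB _ _)).
move: jy; rewrite -real_normK ?num_real//; have := ler_norm y.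
have := normr_ge0 (2 * pi * j%:~R + x); have := normr_ge0 y.
nra.
Qed.

(** A bound on the energy bounds each of the two squares, which confines each component of [n] to a
    finite interval of integers. *)
Lemma finite_energy t : finite_set [set n | energy n <= t].
Proof.
have [N1 b1] := sqr_int_unbounded k.1 (a * (t - b / a)).
have [N2 b2] := sqr_int_unbounded k.2 (a * (t - b / a)).
pose r (N : nat) : set int := [set (i%:Z - N%:Z) | i in `I_(N + N).+1].
have rP N j : (`|j| <= N)%N -> r N j.
  move=> jN; exists (absz (j + N%:Z)%R); last by lia.
  by rewrite /=; lia.
apply: (@sub_finite_set _ _ (r N1 `*` r N2)).
  move=> [n1 n2] /= nt.
  have : a * (energy (n1, n2) - b / a) <= a * (t - b / a).
    by rewrite ler_pM2l// lerD2r.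
  rewrite /energy addrK mulrA mulfV ?gt_eqF// mul1r /= => le12.
  split; apply: rP; [apply: b1|apply: b2]; apply: le_trans le12.
    by rewrite lerDl sqr_ge0.
  by rewrite lerDr sqr_ge0.
by apply: finite_setX; apply: finite_image; exact: finite_II.
Qed.

Lemma infinite_int2 : infinite_set [set: int * int].
Proof.
move=> /finite_seqP[s sT].
have : uniq [seq (i%:Z, 0 : int) | i <- iota 0 (size s).+1].
  by rewrite map_inj_uniq ?iota_uniq// => i j [].
move=> /uniq_leq_size le_s; have := le_s s _.
rewrite size_map size_iota ltnn => /(_ _)/notF; apply=> n _.
by have : [set` s] n by rewrite -sT.
Qed.

Lemma energy_unbounded t : exists n, t < energy n.
Proof.
apply: contrapT => /forallNP all_le; apply: infinite_int2.
apply: sub_finite_set (finite_energy t) => n _ /=.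
by rewrite leNgt; apply/negP/all_le.
Qed.

End Spectrum.

(** * Sorted enumeration of a family with finite sublevel sets *)

Section Enumeration.
Variables (R : realType) (I : choiceType) (F : I -> R).

Lemma seq_argmin (s : seq I) : s != [::] ->
  exists2 i, i \in s & forall j, j \in s -> F i <= F j.
Proof.
elim: s => // i [_ _|j s /(_ isT)[m ms mP] _].
  by exists i => [|j]; rewrite inE// => /eqP ->.
have [im|mi] := leP (F i) (F m).
  exists i; first exact: mem_head.
  move=> l; rewrite inE => /predU1P[->//|/mP]; exact: le_trans.
exists m; first by rewrite inE ms orbT.
by move=> l; rewrite inE => /predU1P[->|/mP//]; exact: ltW.
Qed.

Hypothesis I_infinite : infinite_set [set: I].
Hypothesis F_finite : forall t, finite_set [set i | F i <= t].

(** Greedy choice: at each stage take an index of least value among those not yet taken. *)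
Lemma sorted_enumeration : exists sigma : nat -> I,
  [/\ injective sigma, forall i, exists n, sigma n = i &
      forall m n, (m <= n)%N -> F (sigma m) <= F (sigma n)].
Proof.
have next (s : seq I) : exists i, i \notin s /\ forall j, j \notin s -> F i <= F j.
  have [i0 i0s] : exists i, i \notin s.
    apply: contrapT => /forallNP all_s; apply: I_infinite.
    apply/finite_seqP; exists s; apply/seteqP; split => // i _ /=.
    by apply/negPn/negP/all_s.
  (* Only the finitely many indices of value at most [F i0] compete for the minimum outside [s]. *)
  have /finite_seqP[t tE] := F_finite (F i0).
  have /seteqP[st ts] := tE.
  have tP i : (i \in t) = (F i <= F i0).
    by apply/idP/idP => [/ts|/st].
  have t0 : [seq i <- t | i \notin s] != [::].
    by apply/eqP => /(congr1 (fun u => i0 \in u)); rewrite mem_filter i0s tP lexx.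
  have [i +] := seq_argmin t0.
  rewrite mem_filter => /andP[ins it] iP; exists i; split=> // j js.
  have [ji0|/ltW] := leP (F j) (F i0); first by apply: iP; rewrite mem_filter js tP.
  by apply: le_trans; rewrite -tP.
have [nxt nxtP] := choice next.
(* [L n] lists the first [n] choices, and [sigma n] is the next one. *)
pose L := fix L n := if n is n'.+1 then rcons (L n') (nxt (L n')) else [::].
pose sigma n := nxt (L n).
have LE n : L n = [seq sigma i | i <- iota 0 n].
  by elim: n => // n IH; rewrite -addn1 iotaD map_cat /= add0n -IH cats1 addn1.
have out m n : (m <= n)%N -> sigma n \notin L m.
  move=> mn; have [+ _] := nxtP (L n); rewrite -/(sigma n); apply: contra.
  rewrite (LE m) (LE n) => /mapP [i +]; rewrite mem_iota => im ->.
  by apply: map_f; rewrite mem_iota /=; lia.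
have inj m n : (m < n)%N -> sigma m <> sigma n.
  move=> mn E; have [/negP + _] := nxtP (L n); apply.
  by rewrite -/(sigma n) -E LE; apply: map_f; rewrite mem_iota.
exists sigma; split.
- by move=> m n E; have [/inj/(_ E)|/inj/(_ (esym E))|] := ltngtP m n.
(* If [i] were never taken, it would remain a candidate throughout, so every choice would have value
   at most [F i]: too many distinct indices for a finite sublevel set. *)
- move=> i; apply: contrapT => /forallNP ni.
  have /finite_seqP[t tE] := F_finite (F i).
  have sub : {subset [seq sigma n | n <- iota 0 (size t).+1] <= t}.
    move=> _ /mapP [n _ ->]; suff : [set i' | F i' <= F i] (sigma n) by rewrite tE.
    have [_ +] := nxtP (L n); apply; rewrite LE; apply/negP => /mapP [l _ li].
    exact: (ni l).
  have : uniq [seq sigma n | n <- iota 0 (size t).+1].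
    rewrite map_inj_uniq ?iota_uniq// => m n E.
    by have [/inj/(_ E)|/inj/(_ (esym E))|] := ltngtP m n.
  by move=> /uniq_leq_size /(_ sub); rewrite size_map size_iota ltnn.
- by move=> m n mn; have [_ +] := nxtP (L m); apply; exact: out.
Qed.

End Enumeration.

(** * The eigenvalue sequence of A_k: existence and divergence *)

Section EigenvalueSequence.
Variables (R : realType) (a b : R) (k : R * R).
Hypothesis a_gt0 : 0 < a.
Local Notation A := (A_op a b k).

Lemma card_eq_size (I : choiceType) (sigma : nat -> I) (s : seq I) (P : set nat) :
  injective sigma -> (forall i, exists n, sigma n = i) -> uniq s ->
  (forall n, P n <-> sigma n \in s) -> (P #= `I_(size s))%card.
Proof.
move=> inj surj us Ps.
have E : (P #= [set` s])%card.
  rewrite card_eq_sym (_ : [set` s] = sigma @` P); last first.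
    apply/seteqP; split => [i /= si|_ [n Pn <-] /=]; last exact/Ps.
    by have [n ni] := surj i; exists n => //; apply/Ps; rewrite ni.
  by apply: inj_card_eq; move=> m n _ _; exact: inj.
apply: card_eq_trans E _.
rewrite (_ : [set` s] = (fun n => nth (sigma 0%N) s n) @` `I_(size s)); last first.
  apply/seteqP; split => [i /= si|_ [n /= ns <-]]; last exact: mem_nth.
  by exists (index i s); rewrite /= ?index_mem// nth_index.
apply: inj_card_eq => m n; rewrite !inE /= => ms ns /eqP.
by rewrite nth_uniq// => /eqP.
Qed.

Lemma exists_eigenvalue_sequence :
  exists nu : nat -> R, eigenvalue_sequence A setT nu.
Proof.
have [sigma [inj surj mono]] :=
  sorted_enumeration infinite_int2 (finite_energy b k a_gt0).
exists (fun n => energy a b k (sigma n)); split=> // z _.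
have : finite_set [set n | (energy a b k n)%:C = z].
  apply: sub_finite_set (finite_energy b k a_gt0 (complex.Re z)).
  by move=> n /= <-.
move=> /finite_seqP[t tE]; pose s := undup t.
have sP n : (n \in s) = ((energy a b k n)%:C == z).
  rewrite mem_undup; apply/idP/eqP => [nt|nz].
    by have : [set` t] n by []; rewrite -tE.
  by have : [set n | (energy a b k n)%:C = z] n by []; rewrite tE.
exists (size s); split; first exact: eigen_space_A_op (undup_uniq t) sP.
apply: (card_eq_size inj surj (undup_uniq t)) => n.
by rewrite sP; split => [->|/eqP].
Qed.

(** A value that a sequence never takes has multiplicity 0, so its eigenspace is trivial; this is
    how [eigenvalue_listed] finds every eigenvalue in the list. *)
Lemma has_dim_card0 (V : lmodType R[i]) (E : set V) (n : nat) :
  has_dim E n -> (@set0 nat #= `I_n)%card -> E = [set 0].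
Proof.
move=> [e [_ ->]] /card_esym; rewrite card_eq0 => /eqP n0.
case: n n0 e => [_ e|n].
  apply/seteqP; split => [u [x ->] /=|u ->]; first by rewrite big_ord0.
  by exists (fun=> 0); rewrite big_ord0.
by move=> /seteqP[/(_ 0%N)]; case=> [].
Qed.

Variable nu : nat -> R.
Hypothesis nuA : eigenvalue_sequence A setT nu.

Lemma eigenvalue_listed (z : R[i]) f : eigen_space A z f -> f != 0 ->
  exists j, (nu j)%:C = z.
Proof.
move=> zf f0; apply: contrapT => /forallNP nz.
have [_ _ /(_ z I) [n [dim_n +]]] := nuA.
rewrite (_ : [set j | (nu j)%:C = z] = set0); last first.
  by apply/seteqP; split => j //= /nz.
move=> /(has_dim_card0 dim_n) E; move: zf f0; rewrite E /= => ->.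
by rewrite eqxx.
Qed.

(** Every energy is an eigenvalue and hence listed; the energies are unbounded and [nu] is
    monotone. *)
Lemma cvg_nu : nu @ \oo --> +oo.
Proof.
apply/cvgryPge => t; have [n tn] := energy_unbounded b k a_gt0 t.
have [j nuj] := eigenvalue_listed (eigen_space_mode a b k n) (mode_neq0 R n).
have {}nuj : nu j = energy a b k n by move/(congr1 (@complex.Re R)): nuj.
exists j => // m /= jm; have [mono _ _] := nuA.
by rewrite (le_trans (ltW tn))// -nuj mono.
Qed.

End EigenvalueSequence.

(** * The block operator matrix *)

Section L2Hilbert.
Variable R : realType.
Local Notation mu := (torus_measure R).
Local Notation L2 := (L2 R).
Local Notation dot := (@L2_dot R).
Implicit Types (f g : L2) (z : R[i]) (d : R).

Lemma L2_dotZl z f g : dot (z *: f) g = z * dot f g.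
Proof.
rewrite /L2_dot -cintegralZ; last exact: L2_dot_cintegrable.
apply: ae_eq_cintegral.
- exact: L2_dot_cintegrable.
- exact/cintegrableZ/L2_dot_cintegrable.
- by apply: filterS (L2_reprZ z f) => x /= ->; rewrite mulrA.
Qed.

Lemma L2_dotZr z f g : dot f (z *: g) = z^* * dot f g.
Proof.
rewrite /L2_dot -cintegralZ; last exact: L2_dot_cintegrable.
apply: ae_eq_cintegral.
- exact: L2_dot_cintegrable.
- exact/cintegrableZ/L2_dot_cintegrable.
- by apply: filterS (L2_reprZ z g) => x /= ->; rewrite rmorphM mulrCA.
Qed.

Lemma cintegral_conj (h : _ -> R[i]) : cintegrable h ->
  cintegral (fun x => (h x)^*) = (cintegral h)^*.
Proof.
move=> [h1 h2]; rewrite /cintegral /=; congr (_ +i* _).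
  by congr Rintegral; apply/funext => x; case: (h x).
rewrite -[RHS]mulN1r -RintegralZl//; congr Rintegral; apply/funext => x.
by rewrite mulN1r; case: (h x).
Qed.

Lemma conj_wave n x : (wave n x : R[i])^* = wave (- n) x.
Proof. by rewrite /wave phaseN cosN sinN. Qed.

Lemma L2_dot_mode n f : dot (mode R n) f = (coef n f)^*.
Proof.
rewrite /coef /pairing -cintegral_conj; last first.
  exact/pairing_cintegrable/cbounded_wave.
apply: ae_eq_cintegral.
- exact: L2_dot_cintegrable.
- have [i1 i2] := L2_dot_cintegrable (mode R n) f.
  have := pairing_cintegrable f (cbounded_wave R (- n)).
  move=> /(cintegrableZ 1) [j1 j2]; split.
    move: j1; congr (_.-integrable _ _); apply/funext => x /=; congr (_%:E).
    by rewrite mul1r; case: (_ * _).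
  have := integrable_combination (-1) 0 j2 j1.
  congr (_.-integrable _ _); apply/funext => x /=; congr (_%:E).
  by rewrite mul1r mul0r addr0 mulN1r; case: (_ * _).
- apply: filterS (L2_of_repr (cbounded_wave R n)) => x /= ->.
  have -> : wave n x = (wave (- n) x : R[i])^* by rewrite conj_wave opprK.
  by rewrite mulrC; exact/esym/(rmorphM (@conjc R)).
Qed.

Lemma hnormZ z f :
  hnorm dot (z *: f) = Num.sqrt (complex.Re z ^+ 2 + complex.Im z ^+ 2) * hnorm dot f.
Proof.
rewrite /hnorm -sqrtrM ?addr_ge0 ?sqr_ge0// L2_dotZl L2_dotZr mulrA.
congr Num.sqrt; case: z => x y; case: (dot f f) => u v; rewrite /=.
by ring.
Qed.

Lemma hnormZ_real d f : 0 <= d -> hnorm dot (d%:C *: f) = d * hnorm dot f.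
Proof. by move=> d0; rewrite hnormZ /= expr0n addr0 sqrtr_sqr ger0_norm. Qed.

Lemma hnorm_mode n : hnorm dot (mode R n) = 1.
Proof. by rewrite /hnorm L2_dot_mode coef_mode eqxx rmorph1 /= sqrtr1. Qed.

(** Testing against the modes, any adjoint [S] gives [S v] the same Fourier coefficients as
    [d%:C *: v]; so the chosen adjoint is the obvious one. *)
Lemma adjoint_scale d :
  adjoint dot (fun u => d%:C *: u) = (fun u : L2 => d%:C *: u).
Proof.
have sym : [set S : L2 -> L2 | forall u v, dot (d%:C *: u) v = dot u (S v)]
    (fun u => d%:C *: u).
  move=> u v; rewrite L2_dotZl L2_dotZr; congr (_ * _).
  exact/esym/(conjc_real d).
have := @xgetI _ (fun=> 0) _ _ sym; rewrite -/(adjoint _ _) => /= adj.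
apply/funext => v; apply: coef_inj => n.
apply: (can_inj (@conjcK R)).
exact: etrans (esym (L2_dot_mode n _)) (etrans (esym (adj _ _))
  (etrans (sym _ _) (L2_dot_mode n _))).
Qed.

Lemma opnorm_scale d : 0 <= d -> opnorm dot (fun u => d%:C *: u) = d.
Proof.
move=> d0; rewrite /opnorm; set E := (X in sup X).
have Ed : E d.
  by exists (mode R 0); rewrite /= ?hnormZ_real ?hnorm_mode ?mulr1.
have ubE : ubound E d.
  by move=> _ [u /= u1 <-]; rewrite hnormZ_real// ler_piMr.
apply/eqP; rewrite eq_le; apply/andP; split.
  by apply: ge_sup => //; exists d.
by apply: ub_le_sup => //; exists d.
Qed.

Lemma spectrum_scale d : spectrum dot (fun u => d%:C *: u) = [set d%:C].
Proof.
apply/seteqP; split => [z zs|_ ->] /=; last first.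
  move=> [S [linS _ SK _]]; have := SK (mode R 0); rewrite subrr.
  have -> : S 0 = 0 by have := linS (-1) 0 0; rewrite scaleN1r addNr scaleN1r addNr.
  by move=> /esym/eqP; rewrite (negbTE (mode_neq0 R 0)).
apply: contrapT => zd; apply: zs.
have dz : d%:C - z != 0 by rewrite subr_eq0; apply/eqP => /esym.
exists (fun u => (d%:C - z)^-1 *: u); split.
- by move=> x u v; rewrite scalerDr !scalerA mulrC.
- by exists (Num.sqrt (complex.Re (d%:C - z)^-1 ^+ 2 +
    complex.Im (d%:C - z)^-1 ^+ 2)) => u; rewrite hnormZ.
- by move=> u; rewrite -scalerBl scalerA mulVf// scale1r.
- by move=> u; rewrite -scalerBl scalerA mulfV// scale1r.
Qed.

Lemma min_spectrum_scale d : min_spectrum dot (fun u => d%:C *: u) = d.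
Proof.
rewrite /min_spectrum spectrum_scale.
have dP : [set m : R | [set d%:C] m%:C /\ forall z, [set d%:C] z -> m%:C <= z] d.
  by split=> // z ->.
by have [/= [->]] := @xgetI _ 0 _ _ dP.
Qed.

End L2Hilbert.

(** * Eigenspaces of the block operator as graphs over eigenspaces of A *)

Section BlockOperator.
Variables (R : realType) (A : operator (L2 R)) (beta c : R).
Local Notation B := (fun u : L2 R => beta%:C *: u).
Local Notation calA := (block_operator (@L2_dot R) A B c).
Implicit Types (z : R[i]).

Lemma eigen_space_block z : z != c%:C ->
  eigen_space calA z =
  [set w | eigen_space A (z - beta%:C ^+ 2 / (z - c%:C)) w.1 /\
           w.2 = (beta%:C / (z - c%:C)) *: w.1].
Proof.
move=> zc; have zc0 : z - c%:C != 0 by rewrite subr_eq0.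
apply/seteqP; split => -[u v]; rewrite /eigen_space /= adjoint_scale.
  move=> [Au [Auv /eqP]]; rewrite -[z *: v](subrK (c%:C *: v)) -scalerBl.
  rewrite (inj_eq (addIr _)) => /eqP uv.
  have vE : v = (beta%:C / (z - c%:C)) *: u.
    by rewrite mulrC -scalerA uv scalerA mulVf// scale1r.
  split=> //; split=> //; apply: (addIr (beta%:C *: v)); rewrite Auv vE.
  by rewrite scalerA -scalerDl mulrA -expr2 subrK.
move=> [[Au AuE] ->]; split=> //; rewrite AuE; congr (_, _).
  by rewrite scalerA -scalerDl mulrA -expr2 subrK.
rewrite !scalerA -scalerDl; congr (_ *: _).
by field.
Qed.

(** The map u |-> (u, kappa u) is linear and injective, so it carries a basis to a basis. *)
Lemma has_dim_graph (E : set (L2 R)) (kappa : R[i]) n : has_dim E n ->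
  has_dim [set w : L2 R * L2 R | E w.1 /\ w.2 = kappa *: w.1] n.
Proof.
move=> [e [free ->]].
have sumE (x : 'I_n -> R[i]) : \sum_i x i *: ((e i, kappa *: e i) : L2 R * L2 R) =
    (\sum_i x i *: e i, kappa *: \sum_i x i *: e i).
  elim/big_rec2: _ => [|i p _ _ ->]; first by rewrite scaler0.
  congr (_, _); rewrite [RHS]scalerDr; congr (_ + _).
  by rewrite /= !scalerA [kappa * _]mulrC.
exists (fun i => (e i, kappa *: e i)); split=> [x|].
  by rewrite sumE => -[/free].
apply/seteqP; split => [[u v] /= [[x ->] ->]|_ [x ->]].
  by exists x; rewrite sumE.
by rewrite sumE; split=> //=; exists x.
Qed.

End BlockOperator.

(** * The two solution branches of the spectral equation *)

Section Branches.
Variables (R : realType) (c d : R).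
Hypothesis d_gt0 : 0 < d.
Implicit Types (x y v : R).

(* On either side of [c] the spectral equation (x - v) (x - c) = d reads
   [shifted x = v], with [shifted] increasing. *)
Definition shifted x : R := x - d / (x - c).
Definition lower v : R := (v + c) / 2 - Num.sqrt ((v - c) ^+ 2 / 4 + d).
Definition upper v : R := (v + c) / 2 + Num.sqrt ((v - c) ^+ 2 / 4 + d).

Let root v : R := Num.sqrt ((v - c) ^+ 2 / 4 + d).

Let rootE v : root v ^+ 2 = (v - c) ^+ 2 / 4 + d.
Proof. by rewrite sqr_sqrtr// addr_ge0 ?(ltW d_gt0)// divr_ge0// sqr_ge0. Qed.

(** This strict inequality, due to d > 0, puts [lower v] below both [c] and [v], and [upper v] above
    both. *)
Let root_gt v : `|(v - c) / 2| < root v.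
Proof.
rewrite -sqrtr_sqr ltr_sqrt; last by rewrite ltr_wpDl// divr_ge0// sqr_ge0.
by rewrite expr_div_n -natrX ltrDl.
Qed.

Lemma lower_lt v : lower v < c.
Proof. by have := root_gt v; rewrite ltr_norml /lower -/(root v); lra. Qed.

Lemma upper_gt v : c < upper v.
Proof. by have := root_gt v; rewrite ltr_norml /upper -/(root v); lra. Qed.

Lemma lower_lt_id v : lower v < v.
Proof. by have := root_gt v; rewrite ltr_norml /lower -/(root v); lra. Qed.

Lemma upper_gt_id v : v < upper v.
Proof. by have := root_gt v; rewrite ltr_norml /upper -/(root v); lra. Qed.

Lemma shifted_lower v : shifted (lower v) = v.
Proof.
have c0 : lower v - c != 0 by rewrite subr_eq0 lt_eqF// lower_lt.
apply: (mulIf c0); rewrite /shifted mulrBl divfK//.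
have := rootE v; rewrite /lower -/(root v); lra.
Qed.

Lemma shifted_upper v : shifted (upper v) = v.
Proof.
have c0 : upper v - c != 0 by rewrite subr_eq0 gt_eqF// upper_gt.
apply: (mulIf c0); rewrite /shifted mulrBl divfK//.
have := rootE v; rewrite /upper -/(root v); lra.
Qed.

(** The positive product says that [x] and [y] lie on the same side of [c]; the difference quotient
    1 + d / ((x - c) (y - c)) is then positive. *)
Lemma shifted_increasing x y : 0 < (x - c) * (y - c) -> x < y ->
  shifted x < shifted y.
Proof.
move=> xy0 xy; have /andP[x0 y0] : (x - c != 0) && (y - c != 0).
  by rewrite -negb_or -mulf_eq0 gt_eqF.
rewrite -subr_gt0 (_ : _ - _ = (y - x) * (1 + d / ((x - c) * (y - c)))).
  by rewrite mulr_gt0 ?subr_gt0// addr_gt0// divr_gt0.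
by rewrite /shifted; field; apply/andP.
Qed.

Lemma cvg_lower (u : nat -> R) : u @ \oo --> +oo -> lower (u n) @[n --> \oo] --> c.
Proof.
move=> uoo; apply/cvgrPdist_lt => e e0.
(* With l = lower (u n), one has (c - l) (u n - l) = d. As l < c, the threshold makes the second
   factor exceed d / e, so the first is less than e. *)
have /cvgryPgt /(_ (c + d / e)) : u @ \oo --> +oo by [].
apply: filterS => n un; rewrite gtr0_norm ?subr_gt0 ?lower_lt//.
have h1 := lower_lt (u n); have h2 := lower_lt_id (u n).
have : (c - lower (u n)) * (u n - lower (u n)) = d.
  by have := rootE (u n); rewrite /lower -/(root (u n)); lra.
move=> h3; have : d < e * (u n - lower (u n)).
  by rewrite mulrC -ltr_pdivrMr//; lra.
by rewrite -[X in X < _]h3 ltr_pM2r ?subr_gt0.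
Qed.

Lemma cvg_upper (u : nat -> R) : u @ \oo --> +oo -> upper (u n) @[n --> \oo] --> +oo.
Proof.
move=> uoo; apply/cvgryPge => t; have /cvgryPge /(_ t) := uoo.
by apply: filterS => n tu; rewrite (le_trans tu)// ltW// upper_gt_id.
Qed.

End Branches.

(** * Eigenvalue sequences of the block operator *)

Section BlockSequence.
Variables (R : realType) (A : operator (L2 R)) (c d : R).
Hypothesis d_gt0 : 0 < d.
Local Notation calA := (block_operator (@L2_dot R) A
  (fun u => (Num.sqrt d)%:C *: u) c).

(** One lemma for both branches: [S] is a set on one side of [c], and [lam] inverts [shifted] there.
    The multiplicity of [x] in [S] is that of [shifted c d x] for [A], through the graph description
    of the eigenspaces. *)
Lemma eigenvalue_sequence_block (S : set R) (lam : R -> R) (nu : nat -> R) :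
  (forall x y, S x -> S y -> 0 < (x - c) * (y - c)) ->
  (forall v, S (lam v)) -> (forall v, shifted c d (lam v) = v) ->
  eigenvalue_sequence A setT nu ->
  eigenvalue_sequence calA [set x%:C | x in S] (fun j => lam (nu j)).
Proof.
move=> Sc Slam lamK [mono _ mult].
have lt_shifted x y : S x -> S y -> x < y -> shifted c d x < shifted c d y.
  by move=> Sx Sy; apply: (shifted_increasing d_gt0); exact: Sc.
split=> [i j ij|j|_ [x Sx <-]].
- rewrite leNgt; apply/negP => /(lt_shifted _ _ (Slam _) (Slam _)).
  by rewrite !lamK ltNge mono.
- by exists (lam (nu j)).
- have xc : x%:C != c%:C :> R[i].
    rewrite (inj_eq (fmorph_inj _)) -subr_eq0.
    by have := Sc _ _ Sx Sx; apply: contraTN => /eqP ->; rewrite mul0r ltxx.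
  have [n [dim_n card_n]] := mult (shifted c d x)%:C I.
  exists n; split.
    rewrite eigen_space_block//; apply: has_dim_graph.
    rewrite -rmorphXn sqr_sqrtr ?(ltW d_gt0)//.
    by rewrite -rmorphB -fmorphV -rmorphM -rmorphB.
  rewrite (_ : [set j | _] = [set j | (nu j)%:C = (shifted c d x)%:C])//.
  apply/seteqP; split => j /= /fmorph_inj jx; congr (_%:C).
    by rewrite -jx lamK.
  have [lt|lt|//] := ltgtP (lam (nu j)) x.
    by have := lt_shifted _ _ (Slam _) Sx lt; rewrite lamK jx ltxx.
  by have := lt_shifted _ _ Sx (Slam _) lt; rewrite lamK jx ltxx.
Qed.

End BlockSequence.

(** With l = c + delta, x is an eigenvalue of the Schur complement at l exactly when shifted l + x
    is one of A_k. From l < upper (nu 0) follows shifted l < nu 0, so for x < 0 this lies below the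
    whole spectrum. *)
Lemma schur_no_negative_eigenvalue (R : realType) (a b c delta : R) (k : R * R)
    (nu : nat -> R) : 0 < a -> 0 < c * b / a ->
  eigenvalue_sequence (A_op a b k) setT nu ->
  0 < delta -> c + delta < upper c (c * b / a) (nu 0%N) ->
  negative_eigenvalue_count (schur_op a b c k (c + delta)%:C) 0.
Proof.
move=> a0 d0 nuA delta0; set d := c * b / a in d0 *; set l := c + delta => ltl.
have ll : shifted c d l < nu 0%N.
  rewrite -[ltRHS](shifted_upper c d0); apply: shifted_increasing => //.
  by rewrite mulr_gt0// subr_gt0 ?upper_gt// /l ltrDl.
exists [::]; split=> // x x0 /=.
have S0 : eigen_space (schur_op a b c k l%:C) x%:C = [set 0].
  have schurE f : schur_op a b c k l%:C f = x%:C *: f <->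
      A_op a b k f = (shifted c d l + x)%:C *: f.
    have E : (shifted c d l + x)%:C =
        x%:C + (d%:C * (c%:C - l%:C)^-1) + l%:C :> R[i].
      rewrite -rmorphB -fmorphV -rmorphM -!rmorphD; congr (_%:C).
      by rewrite /shifted -[c - l]opprB invrN mulrN; ring.
    have -> : schur_op a b c k l%:C f = A_op a b k f - l%:C *: f
        - (d%:C * (c%:C - l%:C)^-1) *: f by [].
    rewrite E !scalerDl; split=> [<-|->].
      by rewrite !subrK.
    by rewrite !addrK.
  apply/seteqP; split => [f [Hf /schurE Af]|_ -> /=]; last first.
    split; first exact: H2_0.
    apply/schurE; apply: coef_inj => n; rewrite coef_A_op; last exact: H2_0.
    by rewrite coefZ coef0 !mulr0.
  apply/eqP; apply: contrapT => /negP f0.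
  have [j /fmorph_inj nuj] := eigenvalue_listed nuA (conj Hf Af) f0.
  have [mono _ _] := nuA; have := mono 0%N j (leq0n j).
  by rewrite nuj leNgt (lt_trans _ ll)// gtrDl.
exists (fun _ => 0); split=> [? _ []//|]; rewrite S0.
apply/seteqP; split => [_ ->|_ [? ->]]; last by rewrite big_ord0.
by exists (fun=> 0); rewrite big_ord0.
Qed.

Theorem mainTheorem6 (R : realType) (a b c : R) (k : R * R)
  (a_gt0 : 0 < a) (b_gt0 : 0 < b) (c_gt0 : 0 < c)
  (k1 : - pi < k.1 <= pi) (k2 : - pi < k.2 <= pi) :
  let A := A_op a b k in
  let B := B_op a b c in
  let calA := block_operator (@L2_dot R) A B c in
  (exists nu : nat -> R, eigenvalue_sequence A setT nu) /\
  forall nu : nat -> R, eigenvalue_sequence A setT nu ->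
  let lam1 j := (nu j + c) / 2 - Num.sqrt ((nu j - c) ^+ 2 / 4 + c * b / a) in
  let lam2 j := (nu j + c) / 2 + Num.sqrt ((nu j - c) ^+ 2 / 4 + c * b / a) in
  [/\ eigenvalue_sequence calA [set x%:C | x in [set x : R | x < c]] lam1 /\
        lam1 @ \oo --> c,
      eigenvalue_sequence calA [set x%:C | x in [set x : R | c < x]] lam2 /\
        lam2 @ \oo --> +oo,
      forall delta : R, 0 < delta -> c + delta < lam2 0%N ->
        negative_eigenvalue_count (schur_op a b c k (c + delta)%:C) 0 &
      forall j,
        [/\ lambda1L (@L2_dot R) (nu j) c B = lam1 j,
            lam1 j = lambda1U (@L2_dot R) (nu j) c B,
            lambda2L (@L2_dot R) (nu j) c B = lam2 j &
            lam2 j = lambda2U (@L2_dot R) (nu j) c B]].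
Proof.
move=> A B calA; split; first exact: exists_eigenvalue_sequence.
move=> nu nuA lam1 lam2.
have d0 : 0 < c * b / a by rewrite divr_gt0// mulr_gt0.
have nuoo := cvg_nu a_gt0 nuA.
split.
(* [lam1] and [lam2] are [lower] and [upper] along [nu], with d = c b / a. *)
- split; last exact: (@cvg_lower R c _ d0 nu nuoo).
  apply: (@eigenvalue_sequence_block R A c _ d0 _ (lower c (c * b / a))) => //.
  + by move=> x y /= xc yc; rewrite nmulr_rgt0 subr_lt0.
  + by move=> v; exact: lower_lt.
  + by move=> v; exact: shifted_lower.
- split; last exact: (@cvg_upper R c _ d0 nu nuoo).
  apply: (@eigenvalue_sequence_block R A c _ d0 _ (upper c (c * b / a))) => //.
  + by move=> x y /= xc yc; rewrite pmulr_rgt0 subr_gt0.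
  + by move=> v; exact: upper_gt.
  + by move=> v; exact: shifted_upper.
- by move=> delta; exact: schur_no_negative_eigenvalue.
(* All bounds collapse because [B] is scalar: its squared norm and the least spectral point of B B*
   are the same number. *)
- have opB : opnorm (@L2_dot R) B ^+ 2 = c * b / a.
    by rewrite opnorm_scale ?sqrtr_ge0// sqr_sqrtr ?(ltW d0).
  have specB : min_spectrum (@L2_dot R) (B \o adjoint (@L2_dot R) B) = c * b / a.
    rewrite (_ : B \o _ = fun u => (c * b / a)%:C *: u); last first.
      rewrite adjoint_scale; apply/funext => u /=.
      by rewrite /B /B_op scalerA -rmorphM -expr2 sqr_sqrtr ?(ltW d0).
    exact: min_spectrum_scale.
  have sq j : ((nu j - c) / 2) ^+ 2 = (nu j - c) ^+ 2 / 4.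
    by rewrite expr_div_n -natrX.
  by move=> j; rewrite /lambda1L /lambda1U /lambda2L /lambda2U opB specB sq.
Qed.
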